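(* Fix $H\in(\tfrac12,1)$, $\sigma>0$ and a continuous $a:[0,1]\to\mathbb{R}$. For any sequence of integers $N_n\geq n$, $$\lim_{n\to\infty}\frac{|\mathcal{A}_n^{(N_n,H)}|}{2^{n-1}}=P(|\mathcal{Y}_H|>g_H)>0.$$ In particular, $$\lim_{N\to\infty}\frac{|\mathcal{A}^{(N,H)}|}{2^N-1}=P(|\mathcal{Y}_H|>g_H).$$
   Context: Let $c_H=\sqrt{\frac{2H\,\Gamma(\frac32-H)}{\Gamma(H+\frac12)\Gamma(2-2H)}}$, $C_H=c_H(H-\frac12)$ and $k_H(t,s)=C_H\, s^{\frac12-H}\int_s^t u^{H-\frac12}(u-s)^{H-\frac32}\,du$. For integers $N>1$, $1\le i<n\le N$, set $J_n^{(N,H)}(i)=\sigma\sqrt N\int_{(i-1)/N}^{i/N}\big(k_H(\tfrac nN,u)-k_H(\tfrac{n-1}N,u)\big)du$, and for $1\le n\le N$ set $g_n^{(N,H)}=\sigma\sqrt N\int_{(n-1)/N}^{n/N}k_H(\tfrac nN,u)\,du$ and $a_n^{(N)}=\frac1N a(n/N)$. For $x\in\{-1,1\}^{n-1}$ let $Y_n^{(N,H)}(x)=\sum_{i=1}^{n-1}J_n^{(N,H)}(i)x_i$ (with $Y_1^{(N,H)}=0$), $u_n^{(N)}(x)=Y_n^{(N,H)}(x)+g_n^{(N,H)}$, $d_n^{(N)}(x)=Y_n^{(N,H)}(x)-g_n^{(N,H)}$. The $N$-binary tree is $\mathbb{X}_N=\{\tau\}\cup\bigcup_{n=1}^{N-1}\{-1,1\}^n$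 (so $|\mathbb{X}_N|=2^N-1$). For $n\ge2$, $\mathcal{A}_n^{(N,H)}=\{x\in\{-1,1\}^{n-1}: u_n^{(N)}(x)\le -a_n^{(N)}\text{ or } d_n^{(N)}(x)\ge -a_n^{(N)}\}$; $\mathcal{A}_1^{(N,H)}=\{\tau\}$ if $u_1^{(N)}\le -a_1^{(N)}$ or $d_1^{(N)}\ge -a_1^{(N)}$, and $\emptyset$ otherwise; $\mathcal{A}^{(N,H)}=\bigcup_{n=1}^N\mathcal{A}_n^{(N,H)}$. Let $(\xi_k)_{k\ge1}$ be i.i.d. with $P(\xi_k=1)=P(\xi_k=-1)=\frac12$, $h=\frac H2+\frac14$, $\rho_h(k)=\frac12\big((k+1)^{2h}+(k-1)^{2h}-2k^{2h}\big)$, $g_H=\frac{\sigma c_H}{H+\frac12}$, and $\mathcal{Y}_H=2g_H\sum_{k=1}^\infty\rho_h(k)\xi_k$ (the series converges almost surely). *)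

(* Defs.v *)
From HB Require Import structures.
From mathcomp Require Import all_boot all_order all_algebra.
From mathcomp Require Import all_classical all_reals all_analysis.
Unset Strict Implicit.
Unset Printing Implicit Defensive.
Import Order.TTheory GRing.Theory Num.Theory.
Import numFieldNormedType.Exports.
Local Open Scope classical_set_scope.
Local Open Scope ring_scope.

Section Defs.
Context {R : realType}.

(* Euler Gamma function (used only at positive arguments). *)
Definition Gamma (x : R) : R :=
  \int[@lebesgue_measure R]_(t in `]0, +oo[) (t `^ (x - 1) * expR (- t)).

Definition cH (H : R) : R :=
  Num.sqrt (2 * H * Gamma (3/2 - H) / (Gamma (H + 1/2) * Gamma (2 - 2 * H))).

Definition CH (H : R) : R := cH H * (H - 1/2).

Definition kH (H t s : R) : R :=
  CH H * s `^ (1/2 - H) *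
  \int[@lebesgue_measure R]_(u in `[s, t]) (u `^ (H - 1/2) * (u - s) `^ (H - 3/2)).

(* J_n^{(N,H)}(i), 1 <= i < n <= N *)
Definition J (H sigma : R) (N n i : nat) : R :=
  sigma * Num.sqrt N%:R *
  \int[@lebesgue_measure R]_(u in `[(i.-1)%:R / N%:R, i%:R / N%:R])
     (kH H (n%:R / N%:R) u - kH H ((n.-1)%:R / N%:R) u).

Definition gn (H sigma : R) (N n : nat) : R :=
  sigma * Num.sqrt N%:R *
  \int[@lebesgue_measure R]_(u in `[(n.-1)%:R / N%:R, n%:R / N%:R])
     (kH H (n%:R / N%:R) u).

Definition an (a : R -> R) (N n : nat) : R := a (n%:R / N%:R) / N%:R.

Definition sgnb (b : bool) : R := if b then 1 else -1.

(* Y_n^{(N,H)}(x) = \sum_{i=1}^{n-1} J_n(i) x_i, with x_i = sgnb (x (i-1)) *)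
Definition Yn (H sigma : R) (N n : nat) (x : {ffun 'I_n.-1 -> bool}) : R :=
  \sum_(j < n.-1) J H sigma N n j.+1 * sgnb (x j).

Definition un (H sigma : R) (N n : nat) (x : {ffun 'I_n.-1 -> bool}) : R :=
  Yn H sigma N n x + gn H sigma N n.
Definition dn (H sigma : R) (N n : nat) (x : {ffun 'I_n.-1 -> bool}) : R :=
  Yn H sigma N n x - gn H sigma N n.

Definition inA (H sigma : R) (a : R -> R) (N n : nat)
    (x : {ffun 'I_n.-1 -> bool}) : bool :=
  (un H sigma N n x <= - an a N n) || (- an a N n <= dn H sigma N n x).

(* A_n^{(N,H)} as a subset of {-1,1}^{n-1}; for n = 1, {-1,1}^0 has the single
   element tau (the empty word), and the condition is the one defining A_1. *)
Definition A_n (H sigma : R) (a : R -> R) (N n : nat) : {set {ffun 'I_n.-1 -> bool}} :=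
  [set x | inA H sigma a N n x].

(* The N-binary tree X_N = {tau} u U_{n=1}^{N-1} {-1,1}^n, encoded as pairs
   (m, x) with m < N and x in {-1,1}^m (m = 0 is the root tau). *)
Definition tree (N : nat) : finType := {m : 'I_N & {ffun 'I_m -> bool}}.

(* A^{(N,H)} = U_{n=1}^N A_n^{(N,H)} inside X_N: (m,x) with x in A_{m+1}. *)
Definition A_all (H sigma : R) (a : R -> R) (N : nat) : {set tree N} :=
  [set p : tree N | inA H sigma a N (nat_of_ord (tag p)).+1 (tagged p)].

Definition hH (H : R) : R := H / 2 + 1/4.

Definition rho (h : R) (k : nat) : R :=
  (k.+1%:R `^ (2 * h) + k.-1%:R `^ (2 * h) - 2 * k%:R `^ (2 * h)) / 2.

Definition gH (H sigma : R) : R := sigma * cH H / (H + 1/2).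

End Defs.

Definition mutually_independent {d} {T : measurableType d} {R : realType}
    (P : probability T R) (X : nat -> T -> R) : Prop :=
  forall (F : seq nat) (B : nat -> set R), uniq F ->
    (forall k, k \in F -> measurable (B k)) ->
    P (\bigcap_(k in [set k | k \in F]) (X k @^-1` B k)) =
    (\big[*%E/1%E]_(k <- F) P (X k @^-1` B k))%E.

Definition iid_rademacher {d} {T : measurableType d} {R : realType}
    (P : probability T R) (xi : nat -> T -> R) : Prop :=
  (forall k, measurable_fun setT (xi k)) /\
  mutually_independent P xi /\
  (forall k, P [set w | xi k w = 1] = (1/2)%:E /\ P [set w | xi k w = -1] = (1/2)%:E).

Definition YH {d} {T : measurableType d} {R : realType} (H sigma : R)
    (xi : nat -> T -> R) (w : T) : R :=
  2 * gH H sigma * limn (fun n => \sum_(1 <= k < n) rho (hH H) k * xi k w).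

(* Main.v *)
(** Write [al = H - 1/2] and rescale [J_n^(N)(n - k)], [g_n^(N)] and [a_n^(N)] by
    [N^H / g_H]. Freezing the factors [u^al] and [s^(-al)] in the kernel shows that
    the rescaled coefficients tend to [2 rho_h(k)], uniformly in [N >= n]; since
    they are dominated by [k^(al - 1) (n / (n - k))^al], the convergence holds in
    [l^2]. The rescaled [g_n] tends to [1] and, as [a] is bounded, the rescaled
    [a_n] tends to [0]. The counts are thus, up to a Chebyshev error, the counts of
    sign vectors with [|sum_k 2 rho_h(k) x_k| > 1].

    All the probability takes place on the finite cubes of sign vectors, where flips
    of coordinates are bijections. Flipping after a first passage time yields
    Levy's maximal inequality, hence the almost sure convergence of the series.
    Flipping single coordinates with distinct coefficients produces disjoint
    events of equal size, so that the laws have no atoms in the limit and the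
    counts near the thresholds [-1] and [1] are negligible. As
    [sum_k rho_h(k)] diverges, fixing finitely many signs gives positivity. The last
    limit is a mean with weights [2^(n-1) / (2^N - 1)], and is handled by
    the uniformity in [N]. *)
Require Import Defs.
From HB Require Import structures.
From mathcomp Require Import all_boot all_order all_algebra.
From mathcomp Require Import all_classical all_reals all_analysis.
From mathcomp Require Import measurable_realfun lra ring zify.
Set Implicit Arguments.
Unset Strict Implicit.
Unset Printing Implicit Defensive.
Import Order.TTheory GRing.Theory Num.Theory.
Import numFieldNormedType.Exports.
Local Open Scope classical_set_scope.
Local Open Scope ring_scope.

(** * Integrals of power functions *)

Section integral_tools.
Context {R : realType}.
Notation mu := (@lebesgue_measure R).
Implicit Types (D : set R) (f g F : R -> R).

(* No measurability is needed, since the integral of a nonnegative function is a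
   supremum over the simple functions below it. *)
Lemma ge0_le_integral_nomeas D (f g : R -> \bar R) :
  (forall x, D x -> 0 <= f x)%E -> (forall x, D x -> f x <= g x)%E ->
  (\int[mu]_(x in D) f x <= \int[mu]_(x in D) g x)%E.
Proof.
move=> f0 fg.
have g0 x : D x -> (0 <= g x)%E by move=> Dx; exact: le_trans (f0 _ Dx) (fg _ Dx).
rewrite !ge0_integralE//; apply: ereal_sup_le => _ [h /= hf <-]; exists h => //= x.
apply: le_trans (hf x) _; rewrite !patchE; case: ifPn => // /set_mem; exact: fg.
Qed.

(** The bound by [g2] makes the integral of [f] finite, so [fine] is monotone on the three
    integrals. *)
Lemma ge0_Rintegral_sandwich (D : set (measurableTypeR R)) f g1 g2 : measurable D ->
  mu.-integrable D (EFin \o g1) -> mu.-integrable D (EFin \o g2) ->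
  (forall x, D x -> 0 <= g1 x) -> (forall x, D x -> g1 x <= f x <= g2 x) ->
  \int[mu]_(x in D) g1 x <= \int[mu]_(x in D) f x <= \int[mu]_(x in D) g2 x.
Proof.
move=> mD i1 i2 g0 gfg.
have f0 x : D x -> 0 <= f x.
  by move=> Dx; have /andP[+ _] := gfg _ Dx; apply: le_trans; exact: g0.
have n1 : (\int[mu]_(x in D) (g1 x)%:E <= \int[mu]_(x in D) (f x)%:E)%E.
  by apply: ge0_le_integral_nomeas => x Dx; rewrite lee_fin ?g0//; case/andP: (gfg _ Dx).
have n2 : (\int[mu]_(x in D) (f x)%:E <= \int[mu]_(x in D) (g2 x)%:E)%E.
  by apply: ge0_le_integral_nomeas => x Dx; rewrite lee_fin ?f0//; case/andP: (gfg _ Dx).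
have f1 := integrable_fin_num mD i1; have f2 := integrable_fin_num mD i2.
have ff : (\int[mu]_(x in D) (f x)%:E)%E \is a fin_num.
  rewrite ge0_fin_numE; first by apply: le_lt_trans n2 _; rewrite ltey_eq f2.
  by apply: integral_ge0 => x Dx; rewrite lee_fin f0.
by rewrite /Rintegral !fine_le.
Qed.

(* The integrand may be singular, but integrable, at both end points. *)
Lemma ge0_continuous_FTC2_oo f F (a b : R) : a < b ->
  {in `]a, b[, continuous f} -> {in `]a, b[, forall x, 0 <= f x} ->
  derivable_oo_LRcontinuous F a b -> {in `]a, b[, F^`()%classic =1 f} ->
  (\int[mu]_(x in `[a, b]) (f x)%:E = (F b - F a)%:E)%E.
Proof.
move=> ab cf f0 [dF Fa Fb] F'f.
have mf : measurable_fun `]a, b[ f.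
  apply: open_continuous_measurable_fun; first exact: interval_open.
  by move=> x; rewrite inE => /cf.
rewrite integral_itv_bndoo; last exact/measurable_EFinP.
(* With [n.+3], [e n] is at most a third of [b - a], so every [I n] below is a nondegenerate
   segment. *)
pose e n : R := (b - a) / n.+3%:R.
have e0 n : 0 < e n by rewrite divr_gt0// subr_gt0.
have en n : e n <= (b - a) / 3.
  by rewrite ler_pM2l ?subr_gt0// lef_pV2 ?posrE// ler_nat.
have ecvg : e @ \oo --> 0.
  rewrite -(mulr0 (b - a)); apply: cvgMr.
  by have := @cvg_harmonic R; rewrite -(cvg_shiftn 2) /harmonic/=; under eq_fun do rewrite addn2.
pose I n : set R := `[a + e n, b - e n]%classic.
have Ie : \bigcup_n I n = `]a, b[%classic.
  apply/seteqP; split => [x [n _]|x]; rewrite /I /= !in_itv/=.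
    by move=> /andP[x1 x2]; have := e0 n; lra.
  move=> /andP[ax xb].
  have d0 : 0 < Num.min (x - a) (b - x) by rewrite lt_min !subr_gt0 ax.
  move/cvgrPdist_lt: ecvg => /(_ _ d0) [n _ /(_ n (leqnn _))].
  rewrite /= sub0r normrN ger0_norm ?ltW// lt_min => /andP[n1 n2].
  exists n => //=; rewrite in_itv/=; lra.
have Isub n x : I n x -> x \in `]a, b[.
  by move=> Ix; have : (\bigcup_n I n) x by [exists n]; rewrite Ie.

have mI n : measurable_fun (I n) f.
  by apply: measurable_funS mf => //; rewrite -Ie; exact: bigcup_sup.
(* Monotone convergence along the compact segments [I n]; on each of them the ordinary fundamental
   theorem of calculus applies. *)
have := @ge0_nondecreasing_set_cvg_integral _ (measurableTypeR R) R I (EFin \o f) mu.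
rewrite Ie => cvgI; apply/esym; apply: (cvg_unique _ _ (cvgI _ _ _ _)) => //.
- have abn n : a + e n < b - e n by have := en n; move: ab; lra.
  apply: (@cvg_trans _ ((fun n => (F (b - e n) - F (a + e n))%:E) @ \oo)).
    apply: near_eq_cvg; near=> n; rewrite (@continuous_FTC2 _ f F)//.
    + apply: continuous_in_subspaceT => x; rewrite inE/= => /Isub; exact: cf.
    + split.
      * move=> x xI; apply: dF; apply: (Isub n); exact: subset_itv_oo_cc.
      * apply: cvg_at_right_filter; apply/differentiable_continuous/derivable1_diffP.
        by apply: dF; apply: (Isub n); rewrite /I/= in_itv/= lexx/= ltW.
      * apply: cvg_at_left_filter; apply/differentiable_continuous/derivable1_diffP.
        by apply: dF; apply: (Isub n); rewrite /I/= in_itv/= lexx/= ltW.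
    + move=> x xI; apply: F'f; apply: (Isub n); exact: subset_itv_oo_cc.
  apply: cvg_EFin; first exact: nearW.
  apply: cvgB.
  + apply: (@cvg_comp _ _ _ (fun n => b - e n) F _ (b^'-)) Fb => A hA.
    have cb : (fun n => b - e n) @ \oo --> b.
      by rewrite -[X in _ --> X]subr0; apply: cvgB => //; exact: cvg_cst.
    have : \forall n \near \oo, b - e n < b -> A (b - e n) by exact: (cb _ hA).
    by apply: filterS => n; apply; rewrite gtrBl.
  + apply: (@cvg_comp _ _ _ (fun n => a + e n) F _ (a^'+)) Fa => A hA.
    have ca : (fun n => a + e n) @ \oo --> a.
      by rewrite -[X in _ --> X]addr0; apply: cvgD => //; exact: cvg_cst.
    have : \forall n \near \oo, a < a + e n -> A (a + e n) by exact: (ca _ hA).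
    by apply: filterS => n; apply; rewrite ltrDl.
- move=> m n mn; apply/subsetPset => x; rewrite /I/= !in_itv/=.
  have : e n <= e m.
    by rewrite ler_pM2l ?subr_gt0// lef_pV2 ?posrE// ler_nat.
  lra.
- by move=> i; exact: measurable_itv.
- by move=> i; apply: measurableT_comp => //; exact: mI.
- by move=> i x /Isub /f0; rewrite lee_fin.
Unshelve. all: by end_near. Qed.
End integral_tools.

Section powR_integrals.
Context {R : realType}.
Notation mu := (@lebesgue_measure R).

Lemma powR_continuous (p x : R) : 0 < x -> {for x, continuous (fun y : R => y `^ p)}.
Proof.
move=> x0; apply/differentiable_continuous/derivable1_diffP.
by apply: derivable_powR; rewrite in_itv/= x0.
Qed.

Lemma powR_cvg_at_right (p x : R) : 0 < p -> 0 <= x -> y `^ p @[y --> x^'+] --> x `^ p.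
Proof.
move=> p0; rewrite le_eqVlt => /predU1P[<-|x0].
  by rewrite powR0 ?gt_eqF//; exact: powR_cvg0.
by apply: cvg_at_right_filter; exact: powR_continuous.
Qed.

Lemma is_derive_powR (p x : R) : 0 < x ->
  is_derive x 1 (fun y : R => y `^ p) (p * x `^ (p - 1)).
Proof.
move=> x0; have xp : x \in `]0, +oo[ by rewrite in_itv/= x0.
apply: DeriveDef; first exact: derivable_powR.
by rewrite -derive1E powR_derive1.
Qed.

(** For [p < 1] the integrand blows up at [c], but its primitive $(x-c)^p/p$ stays continuous there,
    as [0 < p]. *)
Lemma integral_powR_subr (p c a b : R) : 0 < p -> c <= a -> a <= b ->
  (\int[mu]_(x in `[a, b]) ((x - c) `^ (p - 1))%:E =
   (((b - c) `^ p - (a - c) `^ p) / p)%:E)%E.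
Proof.
move=> p0 ca; rewrite le_eqVlt => /predU1P[<-|ab].
  by rewrite set_itv1 integral_set1 subrr mul0r.
have pos x : x \in `]a, b[ -> 0 < x - c.
  by rewrite in_itv/= => /andP[ax _]; rewrite subr_gt0 (le_lt_trans ca).
have dF x : 0 < x - c ->
    is_derive x 1 (fun x : R => p^-1 * (x - c) `^ p) ((x - c) `^ (p - 1)).
  move=> x0; have d := is_derive_powR p x0.
  have d2 := @is_derive1_comp R _ _ x _ _ d (is_derive_shift x 1 (- c)).
  have := is_deriveZ p^-1 d2; congr is_derive.
  by rewrite mulr1 /GRing.scale/= mulKf ?gt_eqF.
rewrite (@ge0_continuous_FTC2_oo R _ (fun x => p^-1 * (x - c) `^ p))//.
- by rewrite -mulrBr mulrC.
- move=> x /pos x0.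
  apply: (@continuous_comp _ _ _ (fun x => x - c) (fun y => y `^ (p - 1))).
    by apply: cvgB => //; exact: cvg_cst.
  exact: powR_continuous.
- by move=> x _; exact: powR_ge0.
- split.
  + by move=> x /pos /dF[].
  + apply: cvgMr.
    apply: (@increasing_cvg_at_right_comp R (fun x => x - c) (fun y => y `^ p) a +oo%O).
    * by [].
    * by move=> x y _ _; rewrite ltrD2r.
    * by apply: cvg_at_right_filter; apply: cvgB => //; exact: cvg_cst.
    * by apply: powR_cvg_at_right; rewrite ?subr_ge0.
  + have b0 : 0 < b - c by rewrite subr_gt0 (le_lt_trans ca).
    have [/derivable1_diffP/differentiable_continuous cb _] := dF _ b0.
    exact: cvg_at_left_filter cb.
- by move=> x /pos /dF[_]; rewrite derive1E.
Qed.

Lemma integral_powR_rsubr (p c a b : R) : 0 < p -> b <= c -> a <= b ->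
  (\int[mu]_(x in `[a, b]) ((c - x) `^ (p - 1))%:E =
   (((c - a) `^ p - (c - b) `^ p) / p)%:E)%E.
Proof.
move=> p0 bc; rewrite le_eqVlt => /predU1P[<-|ab].
  by rewrite set_itv1 integral_set1 subrr mul0r.
have pos x : x \in `]a, b[ -> 0 < c - x.
  by rewrite in_itv/= => /andP[_ xb]; rewrite subr_gt0 (lt_le_trans xb).
have cc x : {for x, continuous (fun x => c - x)}.
  by apply: cvgB => //; exact: cvg_cst.
have dF x : 0 < c - x ->
    is_derive x 1 (fun x : R => - p^-1 * (c - x) `^ p) ((c - x) `^ (p - 1)).
  move=> x0; have d := is_derive_powR p x0.
  have dc : is_derive x 1 (fun x : R => c - x) (0 - 1).
    exact: is_deriveB.
  have d2 := @is_derive1_comp R _ _ x _ _ d dc.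
  have := is_deriveZ (- p^-1) d2; congr is_derive.
  by rewrite sub0r mulrN1 /GRing.scale/= mulrNN mulKf ?gt_eqF.
rewrite (@ge0_continuous_FTC2_oo R _ (fun x => - p^-1 * (c - x) `^ p))//.
- by rewrite -mulrBr mulNr -mulrN opprB mulrC.
- move=> x /pos x0.
  apply: (@continuous_comp _ _ _ (fun x => c - x) (fun y => y `^ (p - 1))).
    exact: cc.
  exact: powR_continuous.
- by move=> x _; exact: powR_ge0.
- split.
  + by move=> x /pos /dF[].
  + have a0 : 0 < c - a by rewrite subr_gt0 (lt_le_trans ab).
    have [/derivable1_diffP/differentiable_continuous cca _] := dF _ a0.
    exact: cvg_at_right_filter cca.
  + apply: cvgMr.
    apply: (@decreasing_cvg_at_left_comp R (fun x => c - x) (fun y => y `^ p) -oo%O).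
    * by [].
    * by move=> x y _ _; rewrite ltrD2l ltrN2.
    * by apply: cvg_at_left_filter; exact: cc.
    * by apply: powR_cvg_at_right; rewrite ?subr_ge0.
- by move=> x /pos /dF[_]; rewrite derive1E.
Qed.

Lemma measurable_powR_comp (p : R) (f : R -> R) (D : set R) :
  measurable_fun D f -> measurable_fun D (fun x => f x `^ p).
Proof. by move=> mf; exact: measurableT_comp (measurable_powR p) mf. Qed.

Lemma integrable_EFin_ge0 (D : set (measurableTypeR R)) (f : R -> R) r :
  measurable_fun D f -> (forall x, D x -> 0 <= f x) ->
  (\int[mu]_(x in D) (f x)%:E)%E = r%:E -> mu.-integrable D (EFin \o f).
Proof.
move=> mf f0 fr; apply/integrableP; split; first exact: measurableT_comp.
rewrite (@eq_integral _ _ R mu D (EFin \o f)) ?[X in (X < _)%E]fr ?ltry// => x xD.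
by rewrite /= ger0_norm// f0//; exact: set_mem.
Qed.

Lemma integrable_powR_subr (p c a b : R) : 0 < p -> c <= a -> a <= b ->
  mu.-integrable `[a, b] (EFin \o (fun x => (x - c) `^ (p - 1))).
Proof.
move=> p0 ca ab.
apply: integrable_EFin_ge0 (integral_powR_subr p0 ca ab).
  by apply: measurable_powR_comp; exact: measurable_funB.
by move=> x _; exact: powR_ge0.
Qed.

Lemma integrable_powR_rsubr (p c a b : R) : 0 < p -> b <= c -> a <= b ->
  mu.-integrable `[a, b] (EFin \o (fun x => (c - x) `^ (p - 1))).
Proof.
move=> p0 ca ab.
apply: integrable_EFin_ge0 (integral_powR_rsubr p0 ca ab).
  by apply: measurable_powR_comp; exact: measurable_funB.
by move=> x _; exact: powR_ge0.
Qed.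
End powR_integrals.

(** * Bounds for the kernel and its increments *)

Section powR_inequalities.
Context {R : realType}.
Implicit Types q x y A B : R.

(** Young's inequality for $y^q$ and $1$, with conjugate exponents $1/q$ and $1/(1-q)$. *)
Lemma powR_Bernoulli q y : 0 < q < 1 -> 0 <= y -> y `^ q <= 1 + q * (y - 1).
Proof.
move=> /andP[q0 q1] y0.
have := @conjugate_powR R (y `^ q) 1 q^-1 (1 - q)^-1 (powR_ge0 _ _) ler01.
rewrite !invr_gt0 subr_gt0 !invrK => /(_ q0 q1); rewrite addrC subrK => /(_ erefl).
rewrite mulr1 powR1 mul1r -powRrM mulfV ?gt_eqF// powRr1//.
by move=> /le_trans; apply; rewrite le_eqVlt; apply/orP; left; apply/eqP; ring.
Qed.

Lemma powRV x q : 0 <= x -> x^-1 `^ q = x `^ (- q).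
Proof. by move=> x0; rewrite -(powR_inv1 x0) -powRrM mulN1r. Qed.

Lemma powR_div x y q : 0 <= x -> 0 <= y -> (x / y) `^ q = x `^ q * y `^ (- q).
Proof. by move=> x0 y0; rewrite powRM ?invr_ge0// powRV. Qed.

Lemma le0_ger_powR q x y : q <= 0 -> 0 < x -> x <= y -> y `^ q <= x `^ q.
Proof.
move=> q0 x0 xy; have y0 := lt_le_trans x0 xy.
rewrite -(opprK q) !(powRN _ (- q)) lef_pV2 ?posrE ?powR_gt0//.
by rewrite ge0_ler_powR ?oppr_ge0// nnegrE ltW.
Qed.

Lemma powRB1 x q : 0 < x -> x `^ (q - 1) = x `^ q / x.
Proof. by move=> x0; rewrite powRB ?powRr1 ?(ltW x0)// (gt_eqF x0) implybT. Qed.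

(** Since $B/A\le1$ and $q<1$, $B/A\le(B/A)^q$; multiply by $A^q$. Unlike the mean value bound with
    $B^{q-1}$, this one also covers $B=0$. *)
Lemma powR_sub_le q A B : 0 < q < 1 -> 0 < A -> 0 <= B -> B <= A ->
  A `^ q - B `^ q <= (A - B) * A `^ (q - 1).
Proof.
move=> /andP[q0 q1] A0; rewrite le_eqVlt => /predU1P[<- _|B0 BA].
  by rewrite powR0 ?gt_eqF// !subr0 mulr_powRB1// ltW.
rewrite mulrBl mulr_powRB1 ?(ltW A0)// lerB//.
have := @ger1_powR R (B / A) q.
rewrite divr_gt0// ler_pdivrMr// mul1r BA => /(_ isT (ltW q1)).
have Aq := powR_gt0 q A0.
rewrite powR_div ?(ltW A0) ?(ltW B0)// powRN ler_pdivlMr//; apply: le_trans.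
rewrite powRB1//.
by rewrite mulrA mulrAC.
Qed.

(** Concavity: Bernoulli's inequality at $B/A$, multiplied by $A^q$. *)
Lemma powR_sub_ge q A B : 0 < q < 1 -> 0 < A -> 0 <= B -> B <= A ->
  q * (A - B) * A `^ (q - 1) <= A `^ q - B `^ q.
Proof.
move=> q01 A0 B0 BA; have /andP[q0 q1] := q01.
have := powR_Bernoulli q01 (divr_ge0 B0 (ltW A0)).
rewrite powR_div ?(ltW A0)// powRN.
have Aq := powR_gt0 q A0.
rewrite ler_pdivrMr// => h.
rewrite powRB1//.
have -> : q * (A - B) * (A `^ q / A) = A `^ q - (1 + q * (B / A - 1)) * A `^ q.
  by field; rewrite gt_eqF.
by rewrite lerB.
Qed.
End powR_inequalities.

Section kernel_bounds.
Context {R : realType}.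
Notation mu := (@lebesgue_measure R).
Variable H : R.
Hypothesis H12 : 1/2 < H.

Let al := H - 1/2.
Let al0 : 0 < al. Proof. by rewrite subr_gt0. Qed.

Let ker s u : R := u `^ (H - 1/2) * (u - s) `^ (H - 3/2).

Let ker_ge0 s u : 0 <= ker s u. Proof. by rewrite mulr_ge0// powR_ge0. Qed.

Let al1E : H - 3/2 = al - 1. Proof. by rewrite /al; field. Qed.

Let measurable_ker s (D : set R) : measurable_fun D (ker s).
Proof.
apply: measurable_funM; first exact: measurable_powR_comp.
by apply: measurable_powR_comp; exact: measurable_funB.
Qed.

Let ker_bounds s a b u : 0 <= s -> s <= a -> a <= u <= b ->
  a `^ al * (u - s) `^ (al - 1) <= ker s u <= b `^ al * (u - s) `^ (al - 1).
Proof.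
move=> s0 sa /andP[au ub]; rewrite /ker -/al al1E.
have a0 := le_trans s0 sa; have u0 := le_trans a0 au.
have b0 := le_trans u0 ub.
by apply/andP; split; apply: ler_wpM2r; rewrite ?powR_ge0//;
  apply: ge0_ler_powR; rewrite ?nnegrE ?(ltW al0).
Qed.

Let integrable_cst_ker s a b (c : R) : s <= a -> a <= b ->
  mu.-integrable `[a, b] (EFin \o (fun u => c * (u - s) `^ (al - 1))).
Proof.
move=> sa ab.
have mD : measurable (`[a, b]%classic : set (measurableTypeR R)).
  exact: measurable_itv.
exact: (integrableZl mD c (integrable_powR_subr al0 sa ab)).
Qed.

Let integrable_ker s a b : 0 <= s -> s <= a -> a <= b ->
  mu.-integrable `[a, b] (EFin \o ker s).
Proof.
move=> s0 sa ab; apply: le_integrable (integrable_cst_ker (b `^ al) sa ab) => //.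
  by apply: measurableT_comp => //; exact: measurable_ker.
move=> u; rewrite /= in_itv/= => uab; rewrite lee_fin !ger0_norm//.
  by have /andP[] := ker_bounds s0 sa uab.
by rewrite mulr_ge0// powR_ge0.
Qed.

Let Rintegral_cst_ker s a b (c : R) : s <= a -> a <= b ->
  \int[mu]_(u in `[a, b]) (c * (u - s) `^ (al - 1)) =
  c * (((b - s) `^ al - (a - s) `^ al) / al).
Proof.
move=> sa ab; rewrite RintegralZl//; last exact: integrable_powR_subr.
by rewrite /Rintegral integral_powR_subr.
Qed.

Let Rintegral_ker_bounds s a b : 0 <= s -> s <= a -> a <= b ->
  a `^ al * (((b - s) `^ al - (a - s) `^ al) / al)
   <= \int[mu]_(u in `[a, b]) ker s u
   <= b `^ al * (((b - s) `^ al - (a - s) `^ al) / al).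
Proof.
move=> s0 sa ab; rewrite -!(Rintegral_cst_ker _ sa ab).
apply: ge0_Rintegral_sandwich => //; try exact: integrable_cst_ker.
- by move=> x _; rewrite mulr_ge0// powR_ge0.
- by move=> x; rewrite /= in_itv/=; exact: ker_bounds.
Qed.

Let CHE s : 0 < s -> CH H * s `^ (1/2 - H) = cH H * al * s `^ (- al).
Proof. by move=> s0; rewrite /CH -/al -opprB. Qed.

Let cH0 : 0 <= cH H. Proof. exact: sqrtr_ge0. Qed.

(** On $[s,t]$ the factor of exponent [al] in $u$ lies between its values at $s$ and $t$. What
    remains integrates to a power of $t-s$ divided by [al], and this [al] cancels against the one in
    [CH]. *)
Lemma kH_bounds (t s : R) : 0 < s -> s <= t ->
  cH H * (t - s) `^ al <= kH H t s <= cH H * (t / s) `^ al * (t - s) `^ al.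
Proof.
move=> s0 st.
have := Rintegral_ker_bounds (ltW s0) (lexx s) st.
rewrite subrr powR0 ?(gt_eqF al0)// subr0.
rewrite /kH CHE// -/(ker s).
set I := \int[mu]_(u in _) _ => /andP[h1 h2].
have t0 := lt_le_trans s0 st.
have c0 : 0 <= cH H * al * s `^ (- al) by rewrite !mulr_ge0// ?powR_ge0// ltW.
have sE : s `^ (- al) * s `^ al = 1 by rewrite powRN mulVf// gt_eqF// powR_gt0.
apply/andP; split.
  apply: le_trans (ler_wpM2l c0 h1); rewrite le_eqVlt; apply/orP; left; apply/eqP.
  rewrite -[in LHS](mulr1 (cH H)) -sE; field.
  by rewrite gt_eqF.
apply: le_trans (ler_wpM2l c0 h2) _; rewrite le_eqVlt; apply/orP; left; apply/eqP.
rewrite powR_div ?ltW//; field.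
by rewrite gt_eqF.
Qed.

(** A time increment of the kernel is an integral over $[t',t]$ only, where the power of $u$ is
    frozen at the end points. The case [s = 0] is included because the first cell of the grid starts
    there. *)
Lemma kH_incr_bounds (t t' s : R) : 0 <= s -> s <= t' -> t' <= t ->
  cH H * (t' / s) `^ al * ((t - s) `^ al - (t' - s) `^ al)
  <= kH H t s - kH H t' s
  <= cH H * (t / s) `^ al * ((t - s) `^ al - (t' - s) `^ al).
Proof.
rewrite le_eqVlt => /predU1P[<- _ _|s0 st' tt'].
  (* At [s = 0] every term is $0$ by convention: the inverse of $0$ and the nonzero powers of $0$
     are $0$. *)
  rewrite /kH !invr0 !mulr0 [in 0 `^ (1/2 - H)]powR0; last first.
    by rewrite lt_eqF// subr_lt0.
  by rewrite powR0 ?gt_eqF// !mulr0 !mul0r subrr lexx.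
have := Rintegral_ker_bounds (ltW s0) st' tt'.
have st := le_trans st' tt'.
have t0 := lt_le_trans s0 st; have t'0 := lt_le_trans s0 st'.
rewrite /kH CHE// -mulrBr -/(ker s).
have -> : \int[mu]_(u in `[s, t]) ker s u - \int[mu]_(u in `[s, t']) ker s u =
          \int[mu]_(u in `[t', t]) ker s u.
  rewrite Rintegral_itvB ?bnd_simp//; last exact: integrable_ker (ltW s0) _ st.
  rewrite Rintegral_itv_obnd_cbnd//.
  apply: integrableS (integrable_ker (ltW s0) st' tt'); try exact: measurable_itv.
  by move=> u; rewrite /= !in_itv/= => /andP[/ltW -> ->].
set I := \int[mu]_(u in _) _ => /andP[h1 h2].
have c0 : 0 <= cH H * al * s `^ (- al) by rewrite !mulr_ge0// ?powR_ge0// ltW.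
apply/andP; split.
  apply: le_trans (ler_wpM2l c0 h1); rewrite le_eqVlt; apply/orP; left; apply/eqP.
  rewrite powR_div ?(ltW s0) ?(ltW t'0)//; field.
  by rewrite gt_eqF.
apply: le_trans (ler_wpM2l c0 h2) _; rewrite le_eqVlt; apply/orP; left; apply/eqP.
rewrite powR_div ?(ltW s0) ?(ltW t0)//; field.
by rewrite gt_eqF.
Qed.
End kernel_bounds.

(** * Bounds for [J], [gn] and [rho] *)

Section coefficient_bounds.
Context {R : realType}.
Notation mu := (@lebesgue_measure R).
Variables H sigma : R.
Hypotheses (H12 : 1/2 < H) (H1 : H < 1) (sigma0 : 0 < sigma).

Let al := H - 1/2.
Let p := H + 1/2.
Let al0 : 0 < al. Proof. by rewrite subr_gt0. Qed.
Let al01 : 0 < al < 1.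
Proof. by apply/andP; split=> //; rewrite /al; move: H12 H1; lra. Qed.
Let p0 : 0 < p. Proof. by rewrite /p; move: H12; lra. Qed.
Let p1E : p - 1 = al. Proof. by rewrite /p /al; field. Qed.
Let cH0 : 0 <= cH H. Proof. exact: sqrtr_ge0. Qed.

Lemma rhoSE k :
  2 * rho (hH H) k.+1 = k.+2%:R `^ p + k%:R `^ p - 2 * k.+1%:R `^ p.
Proof.
have -> : rho (hH H) k.+1 = (k.+2%:R `^ p + k%:R `^ p - 2 * k.+1%:R `^ p) / 2.
  by rewrite /rho /= (_ : 2 * hH H = p)// /hH /p; field.
by field.
Qed.

Let X t t' u : R := (t - u) `^ al - (t' - u) `^ al.

Let X_ge0 t t' u : u <= t' -> t' <= t -> 0 <= X t t' u.
Proof.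
move=> ut' tt'; rewrite subr_ge0 ge0_ler_powR ?(ltW al0)// ?nnegrE.
- by rewrite subr_ge0.
- by rewrite subr_ge0 (le_trans ut').
- by rewrite lerB.
Qed.

Let integrable_powRal c a b : b <= c -> a <= b ->
  mu.-integrable `[a, b] (EFin \o (fun u => (c - u) `^ al)).
Proof. by move=> bc ab; rewrite -p1E; exact: integrable_powR_rsubr. Qed.

Let integrable_X t t' a b : b <= t' -> t' <= t -> a <= b ->
  mu.-integrable `[a, b] (EFin \o X t t').
Proof.
move=> bt' tt' ab.
have mD : measurable (`[a, b]%classic : set (measurableTypeR R)).
  exact: measurable_itv.
exact: (integrableB mD (integrable_powRal (le_trans bt' tt') ab) (integrable_powRal bt' ab)).
Qed.

Let integrable_cX c t t' a b : b <= t' -> t' <= t -> a <= b ->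
  mu.-integrable `[a, b] (EFin \o (fun u => c * X t t' u)).
Proof.
move=> bt' tt' ab.
have mD : measurable (`[a, b]%classic : set (measurableTypeR R)).
  exact: measurable_itv.
exact: (integrableZl mD c (integrable_X bt' tt' ab)).
Qed.

Let Rintegral_powRal c a b : b <= c -> a <= b ->
  \int[mu]_(u in `[a, b]) ((c - u) `^ al) = ((c - a) `^ p - (c - b) `^ p) / p.
Proof. by move=> bc ab; rewrite -p1E /Rintegral integral_powR_rsubr. Qed.

Let Rintegral_cX c t t' a b : b <= t' -> t' <= t -> a <= b ->
  \int[mu]_(u in `[a, b]) (c * X t t' u) =
  c * ((((t - a) `^ p - (t - b) `^ p) - ((t' - a) `^ p - (t' - b) `^ p)) / p).
Proof.
move=> bt' tt' ab; rewrite RintegralZl//; last exact: integrable_X.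
have i1 := integrable_powRal (le_trans bt' tt') ab.
rewrite (RintegralB _ i1 (integrable_powRal bt' ab))//.
by rewrite (Rintegral_powRal (le_trans bt' tt') ab) (Rintegral_powRal bt' ab) -mulrBl.
Qed.

(** The source of the common scale $N^{-H}$: the prefactor $\sqrt N$ times the mesh $1/N$ to the
    power [p]. *)
Let sqrt_powR N : (0 < N)%N -> Num.sqrt N%:R * N%:R `^ (- p) = N%:R `^ (- H) :> R.
Proof.
move=> N0; rewrite -powR12_sqrt// -powRD; last by rewrite pnatr_eq0 -lt0n N0 implybT.
by congr (_ `^ _); rewrite /p; field.
Qed.

Let natrDB (N x y : nat) : (x + y)%:R / N%:R - x%:R / N%:R = y%:R / N%:R :> R.
Proof. by rewrite natrD mulrDl addrC addKr. Qed.

(** The integral of [X] over a cell is, up to scaling, a second difference of $x^p$ at $k+1$, that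
    is [2 * rho]. The ratio [t' / u] is at least $1$, and [t / u] is at most [Z = t / a], where the
    left end [a] of the cell is positive since [0 < i]. *)
Lemma J_near_bounds N i k : (0 < N)%N -> (0 < i)%N ->
  gH H sigma * N%:R `^ (- H) * (2 * rho (hH H) k.+1)
  <= J H sigma N (i.+1 + k.+1) i.+1
  <= gH H sigma * N%:R `^ (- H) * ((i.+1 + k.+1)%:R / i%:R) `^ al
     * (2 * rho (hH H) k.+1).
Proof.
move=> N0 i0; rewrite /J rhoSE /=.
have NR : 0 < N%:R :> R by rewrite ltr0n.
have iR : 0 < i%:R :> R by rewrite ltr0n.
have k0 : 0 <= k%:R :> R by [].
set t : R := (i.+1 + k.+1)%:R / N%:R; set t' : R := (i + k.+1)%:R / N%:R.
set a : R := i%:R / N%:R; set b : R := i.+1%:R / N%:R.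
have ab : a <= b by rewrite ler_pM2r ?invr_gt0// ler_nat.
have bt' : b <= t' by rewrite ler_pM2r ?invr_gt0// ler_nat addnS ltnS leq_addr.
have tt' : t' <= t by rewrite ler_pM2r ?invr_gt0// ler_nat leq_add2r.
have a0 : 0 < a by rewrite divr_gt0.
have t'0 : 0 < t' by apply: lt_le_trans bt'; exact: lt_le_trans ab.
have t0 : 0 < t by exact: lt_le_trans tt'.
pose Z : R := (i.+1 + k.+1)%:R / i%:R.
have /andP[h1 h2] : \int[mu]_(u in `[a, b]) (cH H * X t t' u)
    <= \int[mu]_(u in `[a, b]) (kH H t u - kH H t' u)
    <= \int[mu]_(u in `[a, b]) (cH H * Z `^ al * X t t' u).
  apply: ge0_Rintegral_sandwich; first exact: measurable_itv.
  - exact: integrable_cX.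
  - exact: integrable_cX.
  - move=> u; rewrite /= in_itv/= => /andP[au ub].
    by rewrite mulr_ge0// X_ge0// (le_trans ub).
  move=> u; rewrite /= in_itv/= => /andP[au ub].
  have u0 := lt_le_trans a0 au; have ut' := le_trans ub bt'.
  have /andP[l1 l2] := kH_incr_bounds H12 (ltW u0) ut' tt'.
  apply/andP; split.
    apply: le_trans l1; rewrite ler_wpM2r ?X_ge0//.
    rewrite ler_peMr// -[leLHS](powRr0 (t' / u)) ler_powR// ?(ltW al0)//.
    by rewrite ler_pdivlMr// mul1r.
  apply: (le_trans l2); rewrite ler_wpM2r ?X_ge0// ler_wpM2l//.
  rewrite ge0_ler_powR ?(ltW al0)// ?nnegrE.
  - by rewrite divr_ge0// ltW.
  - by rewrite divr_ge0.
  have -> : Z = t / a by rewrite /Z /t /a; field; rewrite !gt_eqF.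
  by rewrite ler_pM2l// lef_pV2.
have e1 : t - a = k.+2%:R / N%:R by rewrite /t addSnnS natrDB.
have e2 : t - b = k.+1%:R / N%:R by exact: natrDB.
have e3 : t' - a = k.+1%:R / N%:R by exact: natrDB.
have e4 : t' - b = k%:R / N%:R by rewrite /t' -addSnnS natrDB.
move: h1 h2; rewrite !Rintegral_cX// e1 e2 e3 e4 !powR_div//.
set I := \int[mu]_(u in _) _ => h1 h2.
have s0 : 0 <= sigma * Num.sqrt N%:R by rewrite mulr_ge0 ?sqrtr_ge0 ?ltW.
rewrite -(sqrt_powR N0) /gH -/p.
apply/andP; split.
  apply: le_trans (ler_wpM2l s0 h1); rewrite le_eqVlt; apply/orP; left; apply/eqP.
  by field; rewrite gt_eqF.
apply: le_trans (ler_wpM2l s0 h2) _; rewrite le_eqVlt; apply/orP; left; apply/eqP.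
by field; rewrite gt_eqF.
Qed.

(** This bound also covers the first cell, where the ratio $t/u$ is unbounded: the negative power of
    $u$ is integrated exactly instead of being frozen, and only then estimated by [powR_sub_le]. *)
Lemma J_far_bound N i k : (0 < N)%N ->
  0 <= J H sigma N (i.+1 + k.+1) i.+1
  <= sigma * cH H / (1 - al) * N%:R `^ (- H) * k.+1%:R `^ (al - 1)
     * ((i.+1 + k.+1)%:R / i.+1%:R) `^ al.
Proof.
move=> N0; rewrite /J /=.
have NR : 0 < N%:R :> R by rewrite ltr0n.
set t : R := (i.+1 + k.+1)%:R / N%:R; set t' : R := (i + k.+1)%:R / N%:R.
set a : R := i%:R / N%:R; set b : R := i.+1%:R / N%:R.
have a0 : 0 <= a by rewrite divr_ge0.
have b0 : 0 < b by rewrite divr_gt0.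
have ab : a <= b by rewrite ler_pM2r ?invr_gt0// ler_nat.
have bt' : b <= t' by rewrite ler_pM2r ?invr_gt0// ler_nat addnS ltnS leq_addr.
have tt' : t' <= t by rewrite ler_pM2r ?invr_gt0// ler_nat leq_add2r.
have t0 : 0 < t by exact: lt_le_trans (le_trans bt' tt').
have be0 : 0 < 1 - al by have /andP[_] := al01; rewrite subr_gt0.
have tb : t - b = k.+1%:R / N%:R by exact: natrDB.
have tt'E : t - t' = N%:R^-1 by rewrite /t addSn -addn1 natrDB mul1r.
(* [c] collects all factors but the negative power of $u$: [powR_sub_le] bounds [X t t' u] by $t-t'$
   times $t-u$ to the power [al - 1], and $t-u\ge t-b$. *)
pose c := cH H * t `^ al * (N%:R^-1 * (k.+1%:R / N%:R) `^ (al - 1)).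
have c0 : 0 <= c by rewrite !mulr_ge0// ?powR_ge0// invr_ge0.
have iU : mu.-integrable `[a, b] (EFin \o (fun u => c * (u - 0) `^ ((1 - al) - 1))).
  have mD : measurable (`[a, b]%classic : set (measurableTypeR R)).
    exact: measurable_itv.
  exact: (integrableZl mD c (integrable_powR_subr be0 a0 ab)).
have /andP[h1 h2] : \int[mu]_(u in `[a, b]) (0 * X t t' u)
    <= \int[mu]_(u in `[a, b]) (kH H t u - kH H t' u)
    <= \int[mu]_(u in `[a, b]) (c * (u - 0) `^ ((1 - al) - 1)).
  apply: ge0_Rintegral_sandwich; first exact: measurable_itv.
  - exact: integrable_cX.
  - exact: iU.
  - by move=> u _; rewrite mul0r.
  move=> u; rewrite /= in_itv/= => /andP[au ub].
  have u0 := le_trans a0 au; have ut' := le_trans ub bt'.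
  have /andP[l1 l2] := kH_incr_bounds H12 u0 ut' tt'.
  have Xu := X_ge0 ut' tt'.
  have tu : 0 < t - u.
    apply: lt_le_trans (_ : t - b <= _); first by rewrite tb divr_gt0.
    by rewrite lerB.
  rewrite mul0r; apply/andP; split.
    by apply: le_trans l1; rewrite !mulr_ge0// powR_ge0.
  apply: (le_trans l2).
  rewrite powR_div ?(ltW t0)// subr0 (_ : 1 - al - 1 = - al); last by ring.
  apply: (@le_trans _ _ (cH H * t `^ al * (X t t' u * u `^ (- al)))).
    by rewrite le_eqVlt; apply/orP; left; apply/eqP; rewrite /X; ring.
  rewrite /c -[leRHS]mulrA ler_wpM2l ?mulr_ge0 ?powR_ge0// ler_wpM2r ?powR_ge0//.
  have t'u : 0 <= t' - u by rewrite subr_ge0.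
  have := powR_sub_le al01 tu t'u (lerB tt' (lexx u)).
  move=> /le_trans; apply.
  rewrite (_ : t - u - (t' - u) = N%:R^-1); last by rewrite -tt'E; ring.
  rewrite ler_wpM2l ?invr_ge0// -tb le0_ger_powR ?lerB//.
    by rewrite subr_le0; have /andP[_ /ltW] := al01.
  by rewrite tb divr_gt0.
have s0 : 0 <= sigma * Num.sqrt N%:R by rewrite mulr_ge0 ?sqrtr_ge0 ?ltW.
move: h1 h2; rewrite Rintegral_cX// mul0r RintegralZl//; last exact: integrable_powR_subr.
have -> : \int[mu]_(u in `[a, b]) ((u - 0) `^ (1 - al - 1)) =
    (b `^ (1 - al) - a `^ (1 - al)) / (1 - al).
  by rewrite /Rintegral integral_powR_subr// !subr0.
set I := \int[mu]_(u in _) _ => h1 h2.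
rewrite mulr_ge0//=; apply: (le_trans (ler_wpM2l s0 h2)).
have be01 : 0 < 1 - al < 1 by rewrite be0/= gtrBl.
have h3 := powR_sub_le be01 b0 a0 ab.
have baE : b - a = N%:R^-1.
  by rewrite /b /a -mulrBl -natrB// subSnn mul1r.
rewrite baE (_ : 1 - al - 1 = - al) in h3; last by ring.
apply: (@le_trans _ _ (sigma * Num.sqrt N%:R * (c * (N%:R^-1 * b `^ (- al) / (1 - al))))).
  by rewrite ler_wpM2l// ler_wpM2l// ler_wpM2r ?invr_ge0 ?(ltW be0).
rewrite le_eqVlt; apply/orP; left; apply/eqP.
have -> : ((i.+1 + k.+1)%:R / i.+1%:R) `^ al = t `^ al * b `^ (- al).
  rewrite -powR_div ?(ltW t0) ?(ltW b0)//; congr (_ `^ _).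
  by rewrite /t /b; field; rewrite !gt_eqF.
rewrite -(sqrt_powR N0) /c (@powR_div _ k.+1%:R N%:R)//.
have -> : N%:R `^ (- p) = N%:R^-1 * (N%:R^-1 * N%:R `^ (- (al - 1))) :> R.
  rewrite -powR_inv1// -!powRD ?pnatr_eq0 -?lt0n ?N0 ?implybT//.
  by congr (_ `^ _); rewrite /p /al; field.
by field; rewrite !gt_eqF.
Qed.

(** The freezing argument on the cell that ends at the current time; the index [n.+1] with [0 < n]
    keeps this cell away from $0$. *)
Lemma gn_bounds N n : (0 < N)%N -> (0 < n)%N ->
  gH H sigma * N%:R `^ (- H)
  <= gn H sigma N n.+1
  <= gH H sigma * N%:R `^ (- H) * (n.+1%:R / n%:R) `^ al.
Proof.
move=> N0 n0; rewrite /gn /=.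
have NR : 0 < N%:R :> R by rewrite ltr0n.
have nR : 0 < n%:R :> R by rewrite ltr0n.
set t : R := n.+1%:R / N%:R; set a : R := n%:R / N%:R.
have a0 : 0 < a by rewrite divr_gt0.
have at_ : a <= t by rewrite ler_pM2r ?invr_gt0// ler_nat.
have t0 : 0 < t by exact: lt_le_trans at_.
pose Z : R := n.+1%:R / n%:R.
have mD : measurable (`[a, t]%classic : set (measurableTypeR R)).
  exact: measurable_itv.
have ic c : mu.-integrable `[a, t] (EFin \o (fun u => c * (t - u) `^ al)).
  exact: (integrableZl mD c (integrable_powRal (lexx t) at_)).
have /andP[h1 h2] : \int[mu]_(u in `[a, t]) (cH H * (t - u) `^ al)
    <= \int[mu]_(u in `[a, t]) kH H t u
    <= \int[mu]_(u in `[a, t]) (cH H * Z `^ al * (t - u) `^ al).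
  apply: ge0_Rintegral_sandwich => //.
    by move=> u _; rewrite mulr_ge0// powR_ge0.
  move=> u; rewrite /= in_itv/= => /andP[au ut].
  have u0 := lt_le_trans a0 au.
  have /andP[l1 l2] := kH_bounds H12 u0 ut.
  apply/andP; split=> //.
  apply: (le_trans l2); rewrite ler_wpM2r ?powR_ge0// ler_wpM2l//.
  rewrite ge0_ler_powR ?(ltW al0)// ?nnegrE.
  - by rewrite divr_ge0// ltW.
  - by rewrite divr_ge0.
  have -> : Z = t / a by rewrite /Z /t /a; field; rewrite !gt_eqF.
  by rewrite ler_pM2l// lef_pV2.
move: h1 h2; rewrite !RintegralZl//; try exact: integrable_powRal.
have baE : t - a = N%:R^-1.
  by rewrite /t /a -mulrBl -natrB// subSnn mul1r.
rewrite Rintegral_powRal// subrr powR0 ?(gt_eqF p0)// subr0 baE powRV//.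
set I := \int[mu]_(u in _) _ => h1 h2.
have s0 : 0 <= sigma * Num.sqrt N%:R by rewrite mulr_ge0 ?sqrtr_ge0 ?ltW.
rewrite -(sqrt_powR N0) /gH -/p.
apply/andP; split.
  apply: le_trans (ler_wpM2l s0 h1); rewrite le_eqVlt; apply/orP; left; apply/eqP.
  by field; rewrite gt_eqF.
apply: le_trans (ler_wpM2l s0 h2) _; rewrite le_eqVlt; apply/orP; left; apply/eqP.
by field; rewrite gt_eqF.
Qed.

(** The second difference of $x^p$ is [p] times the integral of a first difference of the power
    [al]. The times $0$ and $-1$ and the interval $[-(k+2),-(k+1)]$ put it in the form of
    [Rintegral_cX]. *)
Lemma rho_bounds k :
  p * al * k.+2%:R `^ (al - 1) <= 2 * rho (hH H) k.+1 <= p * k.+1%:R `^ (al - 1).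
Proof.
rewrite rhoSE.
set a : R := - k.+2%:R; set b : R := - k.+1%:R.
have ab : a <= b by rewrite lerN2 ler_nat.
have bt : b <= -1 by rewrite lerN2 ler1n.
have t10 : -1 <= 0 :> R by rewrite lerN10.
have iba : b - a = 1 by rewrite /a /b opprK -[k.+2]addn1 natrD addKr.
have mD : measurable (`[a, b]%classic : set (measurableTypeR R)).
  exact: measurable_itv.
have muD : mu `[a, b]%classic = 1%E.
  by rewrite lebesgue_measure_itv/= lte_fin -subr_gt0 iba ltr01 -EFinB iba.
have ic (c : R) : mu.-integrable `[a, b] (EFin \o cst c).
  apply: continuous_compact_integrable; first exact: segment_compact.
  by apply: continuous_subspaceT => x; exact: cvg_cst.
have Ic (c : R) : \int[mu]_(u in `[a, b]) cst c u = c.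
  by rewrite Rintegral_cst// [X in fine X](_ : _ = 1%E) ?mulr1//; exact: muD.
have al1 : 0 < 1 - al by have /andP[_] := al01; rewrite subr_gt0.
have /andP[] : \int[mu]_(u in `[a, b]) cst (al * k.+2%:R `^ (al - 1)) u
    <= \int[mu]_(u in `[a, b]) (1 * X 0 (-1) u)
    <= \int[mu]_(u in `[a, b]) cst (k.+1%:R `^ (al - 1)) u.
  apply: ge0_Rintegral_sandwich => //.
  - by move=> u _; rewrite mulr_ge0 ?powR_ge0 ?ltW.
  move=> u; rewrite /= in_itv/= => /andP[au ub].
  have u0 : 0 < - u by rewrite oppr_gt0 (le_lt_trans ub)// (le_lt_trans bt)// ltrN10.
  have u1 : 0 <= -1 - u by rewrite subr_ge0 (le_trans ub).
  have uu : -1 - u <= - u by rewrite gerDr.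
  have e1 : - u - (-1 - u) = 1 by ring.
  have := powR_sub_ge al01 u0 u1 uu; have := powR_sub_le al01 u0 u1 uu.
  rewrite mul1r /X sub0r e1 mul1r mulr1 => h1 h2.
  have am x y : 0 < x -> x <= y -> y `^ (al - 1) <= x `^ (al - 1).
    by apply: le0_ger_powR; rewrite -opprB oppr_le0 ltW.
  apply/andP; split.
    apply: le_trans h2; rewrite ler_wpM2l ?(ltW al0)// am//.
    by rewrite lerNl.
  by apply: (le_trans h1); rewrite am// lerNr.
rewrite Rintegral_cX// !Ic mul1r !sub0r.
rewrite /a /b !opprK (_ : -1 + k.+2%:R = k.+1%:R); last by rewrite -[k.+2]add1n natrD addKr.
rewrite (_ : -1 + k.+1%:R = k%:R); last by rewrite -[k.+1]add1n natrD addKr.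
rewrite ler_pdivlMr// ler_pdivrMr// => h1 h2; apply/andP; split.
  apply: le_trans (le_trans h1 _); first by rewrite -mulrA mulrC.
  by rewrite le_eqVlt; apply/orP; left; apply/eqP; ring.
apply: le_trans (le_trans h2 _); last by rewrite mulrC.
by rewrite le_eqVlt; apply/orP; left; apply/eqP; ring.
Qed.
End coefficient_bounds.

(** * Positivity of [Gamma] and [cH] *)

Section Gamma_positive.
Context {R : realType}.
Notation mu := (@lebesgue_measure R).

(** Positivity requires finiteness too, since [fine] sends $+\infty$ to $0$. Near $0$ the integrand
    is dominated by a power, and for [x < 2] its tail by an exponential density. *)
Lemma Gamma_gt0 (x : R) : 0 < x < 2 -> 0 < Gamma x.
Proof.
move=> /andP[x0 x2].
pose f t : R := t `^ (x - 1) * expR (- t).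
have f0 t : 0 <= f t by rewrite mulr_ge0 ?powR_ge0 ?expR_ge0.
have mf (D : set R) : measurable_fun D f.
  apply: measurable_funM; first exact: measurable_powR_comp.
  by apply: measurable_funTS; apply: measurableT_comp => //; exact: measurable_oppr.
apply: fine_gt0; apply/andP; split; last first.
  rewrite (_ : `]0, +oo[%classic = `]0, 1] `|` `]1, +oo[); last first.
    by rewrite -itv_bndbnd_setU//= bnd_simp.
  have mA : measurable (`]0, 1]%classic : set (measurableTypeR R)).
    exact: measurable_itv.
  have mB : measurable (`]1, +oo[%classic : set (measurableTypeR R)).
    exact: measurable_itv.
  rewrite (ge0_integral_setU mu mA mB); last 3 first.
  - by apply: measurableT_comp => //; exact: mf.
  - by move=> t _; rewrite lee_fin; exact: f0.
  - rewrite disj_set2E; apply/eqP; apply/seteqP; split => // t [] /=.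
    by rewrite !in_itv/= andbT => /andP[_ t1]; rewrite ltNge t1.
  apply: lte_add_pinfty.
    apply: (@le_lt_trans _ _ (\int[mu]_(t in `[0%R, 1%R]) ((t - 0) `^ (x - 1))%:E)%E).
      apply: le_trans (_ : _ <= \int[mu]_(t in `]0%R, 1%R]) ((t - 0) `^ (x - 1))%:E)%E _.
        apply: ge0_le_integral_nomeas => t; rewrite /= in_itv/= => /andP[t0 t1]; rewrite lee_fin.
          exact: f0.
        by rewrite subr0 ler_piMr ?powR_ge0// -expR0 ler_expR oppr_le0 ltW.
      rewrite integral_itv_obnd_cbnd//.
      by apply/measurable_EFinP; apply: measurable_powR_comp; exact: measurable_funB.
    by rewrite integral_powR_subr// ltry.
  (* Beyond $1$, $t^{x-1}\le t$, and $te^{-t}\le2e^{-t/2}$ follows from $1+t/2\le e^{t/2}$; [g] is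
     that right-hand side. *)
  pose g t : R := 4 * exponential_pdf 2^-1 t.
  have half0 : 0 < 2^-1 :> R by rewrite invr_gt0.
  have ig : mu.-integrable setT (EFin \o g).
    exact: (integrableZl measurableT 4 (integrable_exponential_pdf half0)).
  apply: (@le_lt_trans _ _ (\int[mu]_t (g t)%:E)%E); last first.
    by rewrite ltey_eq (integrable_fin_num _ ig).
  rewrite [leLHS]integral_mkcond; apply: ge0_le_integral_nomeas => t _.
    by rewrite patchE; case: ifPn => // _; rewrite lee_fin; exact: f0.
  have g0 : 0 <= g t by rewrite mulr_ge0// exponential_pdf_ge0// ltW.
  rewrite patchE; case: ifPn => [|_]; last by rewrite lee_fin.
  rewrite inE/= in_itv/= andbT => t1; rewrite lee_fin//.
  have t0 : 0 < t by exact: lt_trans t1.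
  rewrite /g exponential_pdfE ?(ltW t0)// /=.
  apply: (@le_trans _ _ (t * expR (- t))).
    rewrite ler_wpM2r ?expR_ge0// -[leRHS]powRr1 ?(ltW t0)// ler_powR ?(ltW t1)//.
    by rewrite lerBlDr ltW.
  rewrite (_ : - t = - 2^-1 * t + - 2^-1 * t); last by field.
  rewrite expRD !mulrA ler_wpM2r ?expR_ge0// mulNr expRN ler_pdivrMr ?expR_gt0//.
  have := expR_ge1Dx (2^-1 * t); lra.
(* A lower bound on $[1,2]$ suffices: there $t^{x-1}\ge1/t\ge1/2$ and $e^{-t}\ge e^{-2}$. *)
apply: (@lt_le_trans _ _ (\int[mu]_(t in `[1%R, 2%R]) (expR (- 2) / 2)%:E)%E).
  rewrite integral_cst//= lebesgue_measure_itv/= lte_fin ltr1n/= -EFinB -EFinM lte_fin.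
  by rewrite mulr_gt0// ?divr_gt0 ?expR_gt0//; lra.
apply: (@le_trans _ _ (\int[mu]_(t in `[1%R, 2%R]) (f t)%:E)%E).
  apply: ge0_le_integral_nomeas => t; rewrite /= in_itv/= => /andP[t1 t2]; rewrite lee_fin.
    by rewrite divr_ge0 ?expR_ge0.
  rewrite mulrC ler_pM ?expR_ge0// ?invr_ge0//.
    apply: (@le_trans _ _ (t `^ (-1))).
      by rewrite powR_inv1 ?lef_pV2 ?posrE//; move: t1; lra.
    by rewrite ler_powR//; move: x0; lra.
  by rewrite ler_expR lerN2.
apply: ge0_subset_integral => //.
- by apply/measurable_EFinP; exact: mf.
- by move=> t _; rewrite lee_fin.
- by move=> t; rewrite /= !in_itv/= andbT => /andP[t1 _]; exact: lt_le_trans t1.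
Qed.

Lemma cH_gt0 (H : R) : 1/2 < H -> H < 1 -> 0 < cH H.
Proof.
move=> H12 H1; rewrite /cH sqrtr_gt0.
by rewrite divr_gt0// !mulr_gt0// ?Gamma_gt0//; lra.
Qed.
End Gamma_positive.

(** * Sign vectors *)

Section cube.
Context {R : realType}.
Local Notation cube m := {ffun 'I_m -> bool}.

Definition csum (c : nat -> R) m (x : cube m) : R := \sum_(k < m) c k * sgnb (x k).

Definition psum (c : nat -> R) m (i : nat) (x : cube m) : R :=
  \sum_(k < m | (k < i)%N) c k * sgnb (x k).

Definition cprob m (Q : pred (cube m)) : R := #|finset Q|%:R / 2 ^+ m.

Lemma sgnbN b : sgnb (~~ b) = - sgnb b :> R.
Proof. by case: b; rewrite /= ?opprK. Qed.

Lemma sgnb_sqr b : sgnb b ^+ 2 = 1 :> R.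
Proof. by case: b; rewrite /sgnb ?sqrrN expr1n. Qed.

Lemma card_cube m : #|{: cube m}| = (2 ^ m)%N.
Proof. by rewrite card_ffun card_bool card_ord. Qed.

Lemma cprobE m (Q : pred (cube m)) : cprob Q = (\sum_x (Q x)%:R) / 2 ^+ m.
Proof.
congr (_ / _); rewrite -sum1_card natr_sum big_mkcond/=.
by apply: eq_bigr => x _; rewrite inE; case: (Q x).
Qed.

Lemma sum_cst_cube m (a : R) : \sum_(x : cube m) a = a * 2 ^+ m.
Proof. by rewrite sumr_const card_cube -[LHS]mulr_natr natrX. Qed.

Lemma cprob_le m (Q Q' : pred (cube m)) : (forall x, Q x -> Q' x) ->
  cprob Q <= cprob Q'.
Proof.
move=> QQ'; rewrite ler_wpM2r ?invr_ge0 ?exprn_ge0// ler_nat subset_leq_card//.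
by apply/fintype.subsetP => x; rewrite !inE; exact: QQ'.
Qed.

Lemma cprobU m (Q Q1 Q2 : pred (cube m)) : (forall x, Q x -> Q1 x || Q2 x) ->
  cprob Q <= cprob Q1 + cprob Q2.
Proof.
move=> QQ; rewrite !cprobE -mulrDl ler_wpM2r ?invr_ge0 ?exprn_ge0// -big_split/=.
by apply: ler_sum => x _; move: (QQ x); case: (Q x); case: (Q1 x); case: (Q2 x) => //= h;
  rewrite -?natrD ler_nat//; move: (h isT).
Qed.

Lemma cprob_inj m (Q : pred (cube m)) (f : cube m -> cube m) : injective f ->
  cprob (fun x => Q (f x)) = cprob Q.
Proof. by move=> finj; rewrite !cprobE [in RHS](reindex_inj finj). Qed.

Definition cxor m (y x : cube m) : cube m := [ffun k => y k (+) x k].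

Lemma cxorK m (y : cube m) : involutive (cxor y).
Proof. by move=> x; apply/ffunP => k; rewrite !ffunE addKb. Qed.

Definition cflip m (k : nat) : cube m -> cube m := cxor [ffun j : 'I_m => val j == k].

Lemma cflip_inj m k : injective (@cflip m k).
Proof. exact: can_inj (cxorK _). Qed.

(** Flipping the coordinate [j] changes the sign of each summand, so the sum equals its opposite. *)
Lemma sum_sgnb2 m (j k : 'I_m) : j != k ->
  \sum_(x : cube m) sgnb (x j) * sgnb (x k) = 0 :> R.
Proof.
move=> jk; apply/eqP; rewrite -[_ == 0](mulrn_eq0 _ 2) mulr2n.
rewrite [X in X + _](reindex_inj (@cflip_inj m j)) -big_split/= big1// => x _.
by rewrite !ffunE eqxx (negbTE (_ : val k != val j)) ?sgnbN ?mulNr ?addNr// eq_sym.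
Qed.

Lemma sum_csum2 (c : nat -> R) m :
  \sum_(x : cube m) csum c x ^+ 2 = 2 ^+ m * \sum_(k < m) c k ^+ 2.
Proof.
under eq_bigr do rewrite expr2 /csum big_distrlr/=.
rewrite exchange_big/= mulr_sumr; apply: eq_bigr => j _.
rewrite exchange_big/= (bigD1 j)//= [X in _ + X]big1 ?addr0.
  under eq_bigr do rewrite mulrACA -!expr2 sgnb_sqr mulr1.
  by rewrite sum_cst_cube mulrC.
move=> k kj; under eq_bigr do rewrite mulrACA.
by rewrite -mulr_sumr sum_sgnb2 ?mulr0// eq_sym.
Qed.

Lemma cube_chebyshev (c : nat -> R) m (e : R) : 0 < e ->
  cprob (fun x : cube m => e <= `|csum c x|) <= (\sum_(k < m) c k ^+ 2) / e ^+ 2.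
Proof.
move=> e0; rewrite cprobE ler_pdivrMr ?exprn_gt0// mulrAC ler_pdivlMr ?exprn_gt0//.
rewrite [leRHS]mulrC -sum_csum2 mulr_suml; apply: ler_sum => x _.
have [h|h] := leP e `|csum c x|; last first.
  by rewrite [_%:R](_ : _ = 0)// mul0r sqr_ge0.
by rewrite [_%:R](_ : _ = 1)// mul1r -[leRHS]real_normK ?num_real// lerXn2r ?nnegrE// ltW.
Qed.

(** A first passage time is determined by the path up to that time, hence is unchanged by a
    reflection after it. *)
Lemma find_iota_eq n (a b : pred nat) :
  (forall i, (i <= find a (iota 0 n))%N -> a i = b i) ->
  find b (iota 0 n) = find a (iota 0 n).
Proof.
move=> ab.
have fle (f : pred nat) : (find f (iota 0 n) <= n)%N.
  by rewrite -[leqRHS](size_iota 0) find_size.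
have fin (f : pred nat) : (find f (iota 0 n) < n)%N -> f (find f (iota 0 n)).
  move=> fn; have := nth_find 0%N (a := f) (s := iota 0 n).
  by rewrite has_find size_iota nth_iota// add0n; exact.
have fbef (f : pred nat) i : (i < find f (iota 0 n))%N -> f i = false.
  move=> fi; have := before_find 0%N fi.
  by rewrite nth_iota ?add0n//; exact: leq_trans fi (fle f).
apply/eqP; case: ltngtP => // h.
  have hn := leq_trans h (fle a).
  by have := fin b hn; rewrite -(ab _ (ltnW h)) (fbef _ _ h).
have hn := leq_trans h (fle b).
by have := fin a hn; rewrite (ab _ (leqnn _)) (fbef _ _ h).
Qed.

(* Flipping all the signs after the first passage time is an involution, and the
   end points of a path and of its image average to the passage value. *)
Lemma cube_levy (c : nat -> R) m (e : R) :
  cprob (fun x : cube m => [exists i : 'I_m.+1, e < `|psum c i x|])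
  <= 2 * cprob (fun x : cube m => e < `|csum c x|).
Proof.
pose P x i := e < `|psum c i (x : cube m)|.
pose t x := find (P x) (iota 0 m.+1).
pose f x : cube m := [ffun k : 'I_m => if (k < t x)%N then x k else ~~ x k].
have fP x i : (i <= t x)%N -> P x i = P (f x) i.
  move=> it; rewrite /P; congr (_ < `|_|); apply: eq_bigr => k ki.
  by rewrite ffunE (leq_trans ki it).
have tf x : t (f x) = t x by apply: find_iota_eq => i; exact: fP.
have finj : injective f.
  apply: (can_inj (g := f)) => x; apply/ffunP => k; rewrite !ffunE tf.
  by case: (k < t x)%N; rewrite ?negbK.
(* The factor $2$ counts the final event once for [x] and once for its reflection, by invariance
   under [f]. *)
rewrite mulr_natl mulr2n -[X in _ <= _ + X](cprob_inj _ finj).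
apply: cprobU => x /existsP[i Pi].
have tm : (t x < m.+1)%N.
  rewrite -[X in (_ < X)%N](size_iota 0) -has_find; apply/hasP; exists (val i) => //.
  by rewrite mem_iota/= add0n ltn_ord.
have Pt : P x (t x).
  have := nth_find 0%N (a := P x) (s := iota 0 m.+1).
  by rewrite has_find size_iota nth_iota// add0n; exact.
have S2 : csum c x + csum c (f x) = 2 * psum c (t x) x.
  rewrite /csum -big_split/= /psum [in RHS]big_mkcond/= mulr_sumr.
  apply: eq_bigr => k _; rewrite ffunE; case: ifP => _; first by ring.
  by rewrite sgnbN; ring.
rewrite /P in Pt.
case: ltP => //= h1; rewrite ltNge; apply/negP => h2.
have := ler_normD (csum c x) (csum c (f x)).
rewrite S2 normrM ger0_norm//.
lra.
Qed.

Lemma count_le1 (L : seq nat) (b : pred nat) : uniq L ->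
  (forall k l, k \in L -> l \in L -> b k -> b l -> k = l) -> (count b L <= 1)%N.
Proof.
move=> uL bL; rewrite -size_filter.
have : uniq (seq.filter b L) by exact: filter_uniq.
have : forall k l, k \in seq.filter b L -> l \in seq.filter b L -> k = l.
  by move=> k l; rewrite !mem_filter => /andP[? ?] /andP[? ?]; exact: bL.
case: (seq.filter b L) => [|k [|l s]]//= h.
by rewrite inE (h k l) ?eqxx// !inE eqxx ?orbT.
Qed.

Lemma csum_flip (c : nat -> R) m (k : 'I_m) (x : cube m) :
  csum c (cflip k x) = csum c x - 2 * c k * sgnb (x k).
Proof.
rewrite /csum (bigD1 k)//= [X in _ = X - _](bigD1 k)//= !ffunE eqxx sgnbN.
rewrite (eq_bigr (fun j : 'I_m => c j * sgnb (x j))).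
  by ring.
by move=> j jk; rewrite !ffunE (negbTE (_ : val j != val k)).
Qed.

(* The [size L] events obtained by flipping one coordinate of [L] are disjoint. *)
Lemma cube_anticoncentration (c : nat -> R) m (L : seq nat) (e y : R) :
  uniq L -> (forall k, k \in L -> (k < m)%N) -> (forall k, 0 <= c k) ->
  (forall k l, k \in L -> l \in L -> k != l -> e < `|c k - c l|) ->
  (size L)%:R * cprob (fun x : cube m => `|csum c x - y| <= e) <= 1.
Proof.
move=> uL Lm c0 Le.
pose E (x : cube m) := `|csum c x - y| <= e.
have -> : (size L)%:R * cprob E = \sum_(k <- L) cprob (fun x => E (cflip k x)).
  rewrite (eq_bigr (fun=> cprob E)) ?big_const_seq ?count_predT.
    by rewrite iter_addr_0 mulr_natl.
  by move=> k _; rewrite (cprob_inj E (@cflip_inj m k)).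
rewrite (eq_bigr _ (fun k _ => cprobE _)) -mulr_suml exchange_big/=.
rewrite ler_pdivrMr ?exprn_gt0// -sum_cst_cube; apply: ler_sum => x _.
rewrite -natr_sum -[1]/(1%:R) ler_nat.
rewrite (_ : (\sum_(k <- L) _)%N = count (fun k => E (cflip k x)) L); last first.
  by rewrite -sum1_count [RHS]big_mkcond/=; apply: eq_bigr => k _; case: (E _).
(* Two such flips would give values that differ by $2|c_k\pm c_l|$, which is at least
   $2|c_k-c_l|>2e$ as [c] is nonnegative, whereas the window has length $2e$. *)
apply: count_le1 => // k l kL lL Ek El; apply/eqP; apply/negPn/negP => kl.
have := Le _ _ kL lL kl; rewrite ltNge => /negP; apply.
move: Ek El; rewrite /E.
have -> : k = Ordinal (Lm _ kL) by [].
have -> : l = Ordinal (Lm _ lL) by [].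
rewrite !csum_flip/=.
move: (c0 k) (c0 l).
set a := c k; set b := c l; set S := csum c x.
rewrite !ler_norml /sgnb => a0 b0.
by case: (x (Ordinal (Lm _ kL))); case: (x (Ordinal (Lm _ lL)));
  move=> /andP[? ?] /andP[? ?]; apply/andP; split; lra.
Qed.

(* Every sign vector is sent into the event by one of the [2 ^ (M + 1)] maps that
   flip some of the first [M] signs and flip all or none of the others: make the
   first [M] signs positive, and one of the two choices for the rest does not
   decrease the sum. *)
Lemma cube_positive (c : nat -> R) M m (y : R) : (M <= m)%N ->
  y < \sum_(k < M) c k ->
  1 <= 2 ^+ M.+1 * cprob (fun x : cube m => y < csum c x).
Proof.
move=> Mm ySM.
pose mask (z : cube M) (b : bool) : cube m :=
  [ffun k : 'I_m => if insub (val k) is Some k' then z k' else b].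
pose E (x : cube m) := y < csum c x.
have -> : 2 ^+ M.+1 * cprob E =
    \sum_(p : cube M * bool) cprob (fun x => E (cxor (mask p.1 p.2) x)).
  rewrite (eq_bigr (fun=> cprob E)).
    by rewrite sumr_const card_prod card_cube card_bool -[in RHS]mulr_natl natrM natrX -exprSr.
  by move=> p _; apply: cprob_inj; exact: can_inj (cxorK _).
rewrite (eq_bigr _ (fun k _ => cprobE _)) -mulr_suml exchange_big/=.
rewrite ler_pdivlMr ?exprn_gt0// -sum_cst_cube; apply: ler_sum => x _.
pose z : cube M := [ffun k => ~~ x (widen_ord Mm k)].
have inM (k : 'I_m) : (k < M)%N -> forall b, cxor (mask z b) x k = true.
  move=> kM b; rewrite !ffunE insubT/= ffunE.
  by rewrite (_ : widen_ord _ _ = k) ?addNb ?addbb//; exact: val_inj.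
have outM (k : 'I_m) : (M <= k)%N -> forall b, cxor (mask z b) x k = b (+) x k.
  by move=> Mk b; rewrite !ffunE insubF// ltnNge Mk.
have SE b : csum c (cxor (mask z b) x) = \sum_(k < M) c k +
    \sum_(k < m | ~~ (k < M)%N) c k * sgnb (b (+) x k).
  rewrite /csum (bigID (fun k : 'I_m => (k < M)%N))/=; congr (_ + _).
    rewrite [RHS](big_ord_widen_cond m xpredT (fun k => c k) Mm).
    by apply: eq_bigr => k kM; rewrite inM// mulr1.
  by apply: eq_bigr => k; rewrite -leqNgt => Mk; rewrite outM.
(* The contributions of the last coordinates cancel, so the two sums average to $\sum_{k<M}c_k>y$
   and one of them exceeds [y]. *)
have SE2 : csum c (cxor (mask z false) x) + csum c (cxor (mask z true) x) =
    2 * \sum_(k < M) c k.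
  rewrite !SE addrACA -[X in _ + X]big_split/= [X in _ + X]big1.
    by rewrite addr0 mulr_natl mulr2n.
  by move=> k _; rewrite sgnbN mulrN addrN.
have [b Eb] : exists b, E (cxor (mask z b) x).
  have [h|h] := ltP y (csum c (cxor (mask z false) x)); first by exists false.
  by exists true; rewrite /E; lra.
rewrite (bigD1 (z, b))//= Eb -[leLHS]addr0 lerD// sumr_ge0//.
Qed.
End cube.

(** * Rademacher sequences *)

Section signs.
Context {R : realType} {d : measure_display} {T : measurableType d}.
Variables (P : probability T R) (xi : nat -> T -> R).
Hypothesis iid : iid_rademacher P xi.
Local Notation cube m := {ffun 'I_m -> bool}.

Let mxi k : measurable_fun setT (xi k). Proof. by case: iid. Qed.

Let mxi_pre k (B : set R) : measurable B -> measurable (xi k @^-1` B).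
Proof. by move=> mB; rewrite -[X in measurable X]setTI; exact: mxi. Qed.

(** The shift [k.+1] is due to the series starting at $1$. Values other than $1$ are read as $-1$,
    which is correct almost surely. *)
Definition bvec m (w : T) : cube m := [ffun k : 'I_m => xi k.+1 w == 1].

(** The complement of $\{1\}$, rather than $\{-1\}$, makes the atoms of [bvec] exact intersections,
    with no null set to discard. *)
Let side (b : bool) : set R := if b then [set 1] else ~` [set 1].

Let measurable_side b : measurable (side b).
Proof. by case: b => //=; exact: measurableC. Qed.

Let P_side k b : P (xi k @^-1` side b) = (2^-1)%:E.
Proof.
have [_ [_ /(_ k)[P1 _]]] := iid.
have P1' : P (xi k @^-1` side true) = (2^-1)%:E by rewrite -[2^-1]mul1r -P1.
case: b => //.
rewrite (_ : _ @^-1` _ = ~` (xi k @^-1` side true))//.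
rewrite probability_setC; last exact: mxi_pre.
by rewrite P1' -EFinB; congr EFin; field.
Qed.

Let bvec_atomE m (x : cube m) : [set w | bvec m w = x] =
  \bigcap_(k in [set k | k \in iota 1 m])
    (xi k @^-1` side (if insub k.-1 is Some j then x j else true)).
Proof.
apply/seteqP; split => w /=.
  move=> <- k /=; rewrite mem_iota => /andP[k0 km].
  have km' : (k.-1 < m)%N by case: k k0 km.
  rewrite insubT ffunE/= prednK//.
  by case: eqP.
move=> h; apply/ffunP => k; rewrite ffunE.
have := h k.+1; rewrite /= mem_iota add1n !ltnS ltn_ord => /(_ isT).
rewrite (valK k).
by case: (x k) => /= [->|/eqP/negbTE->]; rewrite ?eqxx.
Qed.

Let measurable_atom m (x : cube m) : measurable [set w | bvec m w = x].
Proof.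
rewrite bvec_atomE; apply: bigcap_measurableType => k _.
by apply: mxi_pre; exact: measurable_side.
Qed.

Let P_atom m (x : cube m) : P [set w | bvec m w = x] = (2 ^- m)%:E.
Proof.
have [_ [ind _]] := iid.
rewrite bvec_atomE (ind _ _ (iota_uniq 1 m) (fun k _ => measurable_side _)).
rewrite (eq_bigr (fun=> (2^-1)%:E)); last by move=> k _; exact: P_side.
rewrite big_const_seq count_predT size_iota.
by elim: m {x} => [|m IH]; rewrite ?expr0 ?invr1// iterS IH -EFinM exprS invfM.
Qed.

Let P_seq m (r : seq (cube m)) : uniq r ->
  measurable [set w | bvec m w \in r] /\
  P [set w | bvec m w \in r] = ((size r)%:R / 2 ^+ m)%:E.
Proof.
elim: r => [_|x r IH /= /andP[xr ur]].
  rewrite (_ : [set _ | _] = set0) ?measure0 ?mul0r//.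
  by apply/seteqP; split => w //=; rewrite in_nil.
have [mr Pr] := IH ur.
rewrite (_ : [set _ | _] = [set w | bvec m w = x] `|` [set w | bvec m w \in r]); last first.
  apply/seteqP; split => w /=; rewrite inE; first by case/orP=> [/eqP|]; [left|right].
  by case=> [->|->]; rewrite ?eqxx ?orbT.
split; first exact: measurableU.
rewrite measureU//; last first.
  by apply/seteqP; split => w //= [->]; rewrite (negbTE xr).
transitivity ((2 ^- m : R)%:E + ((size r)%:R / 2 ^+ m : R)%:E)%E.
  by congr (_ + _)%E; [exact: P_atom|exact: Pr].
by rewrite -EFinD -(natr1 (size r)) mulrDl mul1r addrC.
Qed.

Lemma measurable_bvec m (Q : pred (cube m)) : measurable [set w | Q (bvec m w)].
Proof.
have [+ _] := P_seq (enum_uniq Q); congr measurable.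
by apply/seteqP; split => w /=; rewrite mem_enum.
Qed.

(** The signs are uniform on the cube, as independence gives every atom the mass $2^{-m}$. This
    carries the counting estimates over to [P]. *)
Lemma P_bvec m (Q : pred (cube m)) : P [set w | Q (bvec m w)] = (cprob Q)%:E.
Proof.
have [_] := P_seq (enum_uniq Q).
rewrite -cardE /cprob cardsE => <-; congr (P _).
by apply/seteqP; split => w /=; rewrite mem_enum.
Qed.

Lemma sign_or_negligible : exists N : set T,
  [/\ measurable N, P N = 0 &
    forall w, ~ N w -> forall k, xi k w = sgnb (xi k w == 1)].
Proof.
have [_ [_ xi1]] := iid.
pose N := \bigcup_k ~` (xi k @^-1` [set 1] `|` xi k @^-1` [set -1]).
have mN k : measurable (~` (xi k @^-1` [set 1] `|` xi k @^-1` [set -1])).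
  by apply: measurableC; apply: measurableU; exact: mxi_pre.
have P0 k : P (~` (xi k @^-1` [set 1] `|` xi k @^-1` [set -1])) = 0%E.
  rewrite probability_setC; last by apply: measurableU; exact: mxi_pre.
  rewrite measureU; try exact: mxi_pre; last first.
    apply/seteqP; split => w //= [->] /eqP; rewrite -subr_eq0 opprK.
    by rewrite -mulr2n pnatr_eq0.
  have [p1 p2] := xi1 k.
  transitivity (1%:E - ((1/2)%:E + (1/2)%:E) : \bar R)%E.
    by congr (_ - (_ + _))%E.
  by rewrite -[LHS]/((1 - (1 / 2 + 1 / 2) : R)%:E); congr EFin; field.
exists N; split.
- exact: bigcupT_measurable.
- apply/negligibleP; first exact: bigcupT_measurable.
  by apply: negligible_bigcup => k; apply/negligibleP => //; exact: P0.
- move=> w Nw k; have : (xi k @^-1` [set 1] `|` xi k @^-1` [set -1]) w.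
    by apply: contrapT => h; apply: Nw; exists k.
  move=> [/= ->|/= ->]; first by rewrite eqxx.
  by rewrite (_ : _ == _ = false)// -subr_eq0 -opprD oppr_eq0 -mulr2n pnatr_eq0.
Qed.
End signs.

(** * Measurability of limits *)

Section measurable_limit.
Context {R : realType} {d : measure_display} {T : measurableType d}.

(** With quantifiers over the integers [j], [M] and [i] only, the set of convergence is seen to be
    measurable in the next lemma. *)
Lemma cvgn_real_cauchyP (u : nat -> R) : cvgn u <->
  forall j : nat, exists M : nat, forall i : nat, (M <= i)%N ->
    `|u i - u M| <= j.+1%:R^-1.
Proof.
split=> [cu j|h].
  have j0 : 0 < j.+1%:R^-1 / 2 :> R by rewrite divr_gt0// invr_gt0.
  move/cvgrPdist_lt: cu => /(_ _ j0) [M _ HM]; exists M => i Mi.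
  have := HM i Mi; have := HM M (leqnn M); rewrite /= => h1 h2.
  rewrite (_ : u i - u M = (limn u - u M) - (limn u - u i)); last by ring.
  by rewrite (le_trans (ler_normB _ _))// [leRHS]splitr lerD// ltW.
apply: cauchy_cvg; apply/cauchyP => e e0.
have [j _ /(_ j (leqnn j))] := near_infty_natSinv_lt (PosNum e0).
rewrite /= => je.
have [M HM] := h j; exists (u M); exists M => // i Mi.
rewrite /= -ball_normE/= distrC; exact: le_lt_trans (HM i Mi) je.
Qed.

(** Off the set of convergence, [limn] takes the default value [point] and is therefore constant. *)
Lemma measurable_fun_limn (h : nat -> T -> R) :
  (forall n, measurable_fun setT (h n)) ->
  measurable_fun setT (fun w => limn (h ^~ w)).
Proof.
move=> mh; pose C := [set w | cvgn (h ^~ w)].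
have mC : measurable C.
  rewrite (_ : C = \bigcap_j \bigcup_M \bigcap_(i in [set i | (M <= i)%N])
      [set w | `|h i w - h M w| <= j.+1%:R^-1]).
    apply: bigcapT_measurable => j; apply: bigcupT_measurable => M.
    apply: bigcap_measurableType => i _.
    rewrite (_ : [set w | _] = setT `&` (fun w => `|h i w - h M w|) @^-1` `]-oo, j.+1%:R^-1]).
      apply: measurableT_comp => //.
      exact: measurable_funB.
    by apply/seteqP; split => w /=; rewrite in_itv/= => // -[].
  apply/seteqP; split => w; rewrite /C/=.
    by move=> /cvgn_real_cauchyP cw j _; have [M HM] := cw j; exists M => // i /HM.
  move=> hw; apply/cvgn_real_cauchyP => j.
  by have [M _ HM] := hw j I; exists M => i Mi; exact: HM.
rewrite -(setUv C); apply/measurable_funU => //; first exact: measurableC.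
split.
  by apply: (measurable_fun_cvg (h := h)) => [m|w //]; exact: measurable_funTS.
apply: (eq_measurable_fun (cst point)) => // w; rewrite inE => wC.
by rewrite dvgP.
Qed.
End measurable_limit.

(** * Almost sure convergence of a series with random signs *)

Section random_series.
Context {R : realType} {d : measure_display} {T : measurableType d}.
Variables (P : probability T R) (xi : nat -> T -> R).
Hypothesis iid : iid_rademacher P xi.
Local Notation cube m := {ffun 'I_m -> bool}.
Variables (c tau : nat -> R).
Hypothesis tail : forall M m, \sum_(M <= k < m) c k ^+ 2 <= tau M.
Hypothesis tau0 : tau @ \oo --> 0.

Let s m w := csum c (bvec xi m w).

(** Erasing the first [M] coefficients turns the maximal inequality for partial sums into one for
    the increments after [M]. *)
Let ctail M k : R := if (k < M)%N then 0 else c k.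

Let psum_bvec (c' : nat -> R) i m w : (i <= m)%N ->
  psum c' i (bvec xi m w) = \sum_(0 <= k < i) c' k * sgnb (xi k.+1 w == 1).
Proof.
move=> im; rewrite big_mkord (big_ord_widen m (fun k => c' k * sgnb (xi k.+1 w == 1)) im).
by apply: eq_bigr => k _; rewrite ffunE.
Qed.

Let csum_bvec i w : s i w = \sum_(0 <= k < i) c k * sgnb (xi k.+1 w == 1).
Proof. by rewrite big_mkord; apply: eq_bigr => k _; rewrite ffunE. Qed.

Let exceeds M (e : R) m : pred (cube m) :=
  fun x => [exists i : 'I_m.+1, e < `|psum (ctail M) i x|].

Let dev M (e : R) m := [set w | exceeds M e (bvec xi m w)].

(** For $e\ge0$, the event $\sup_{i\ge M}|s_i-s_M|>e$, written as an increasing union of events on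
    finitely many signs. *)
Definition deviation M (e : R) := \bigcup_m dev M e m.

Let measurable_dev M e m : measurable (dev M e m).
Proof. exact: (measurable_bvec iid (exceeds M e (m := m))). Qed.

Lemma measurable_deviation M e : measurable (deviation M e).
Proof. by apply: bigcupT_measurable => m; exact: measurable_dev. Qed.

Lemma deviationN M e w : ~ deviation M e w -> forall i, (M <= i)%N -> `|s i w - s M w| <= e.
Proof.
move=> nD i Mi; rewrite leNgt; apply/negP => h; apply: nD.
exists i => //=; apply/existsP; exists ord_max => /=; move: h.
have -> : s i w - s M w = \sum_(M <= k < i) c k * sgnb (xi k.+1 w == 1).
  by rewrite !csum_bvec (big_cat_nat (leq0n M) Mi)/= addrAC subrr add0r.
rewrite psum_bvec// (big_cat_nat (leq0n M) Mi)//= [X in _ -> _ < `|X + _|]big1_seq ?add0r.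
  congr (_ < `|_|); apply: eq_big_nat => k /andP[Mk _].
  by rewrite /ctail ltnNge Mk.
by move=> k /=; rewrite mem_index_iota => /andP[_ kM]; rewrite /ctail kM mul0r.
Qed.

(** By continuity from below it suffices to bound each [dev M e m]: Levy's inequality gives the
    factor $2$, and Chebyshev's the tail of the squares. *)
Lemma P_deviation M e : 0 < e -> (P (deviation M e) <= (2 * tau M / e ^+ 2)%:E)%E.
Proof.
move=> e0.
have cv := @nondecreasing_cvg_mu _ _ _ P (dev M e) (measurable_dev M e)
  (measurable_deviation M e).
have nd : {homo dev M e : n m / (n <= m)%N >-> (n <= m)%O}.
  move=> m m' mm'; apply/subsetPset => w /existsP[i].
  have mm1 : (m.+1 <= m'.+1)%N by [].
  rewrite psum_bvec; last by rewrite -ltnS.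
  move=> h; apply/existsP; exists (widen_ord mm1 i).
  by rewrite psum_bvec//= -ltnS (leq_trans (ltn_ord i)).
rewrite -(cvg_lim _ (cv nd))//.
apply: lime_le; first exact: cvgP (cv nd).
near=> m => /=.
rewrite [leLHS](P_bvec iid) lee_fin.
apply: (le_trans (cube_levy _ _ _)); rewrite -!mulrA ler_wpM2l//.
apply: (@le_trans _ _ (cprob (fun x : cube m => e <= `|csum (ctail M) x|))).
  by apply: cprob_le => x; exact: ltW.
apply: (le_trans (cube_chebyshev _ _ e0)); rewrite ler_wpM2r ?invr_ge0 ?sqr_ge0//.
apply: le_trans (tail M m).
rewrite -(big_mkord xpredT (fun k => ctail M k ^+ 2)).
have [Mm|mM] := leqP M m.
  rewrite (big_cat_nat (leq0n M) Mm)//= [X in X + _]big1_seq ?add0r.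
    rewrite le_eqVlt; apply/orP; left; apply/eqP; apply: eq_big_nat => k /andP[Mk _].
    by rewrite /ctail ltnNge Mk.
  by move=> k /=; rewrite mem_index_iota => /andP[_ kM]; rewrite /ctail kM expr0n.
rewrite big1_seq ?sumr_ge0// => [k _|k /=]; first exact: sqr_ge0.
by rewrite mem_index_iota => /andP[_ km]; rewrite /ctail (ltn_trans km mM) expr0n.
Unshelve. all: by end_near. Qed.

(** [N] consists of the points at which some level $1/(j+1)$ is exceeded after every [M];
    [P_deviation] and [tau0] make it null. Elsewhere the partial sums are Cauchy, and bounds on
    increments pass to the limit. *)
Lemma random_series_cvg : exists N : set T, [/\ measurable N, P N = 0%E &
  forall w, ~ N w -> cvgn (s ^~ w) /\
    (forall M e, ~ deviation M e w -> `|limn (s ^~ w) - s M w| <= e)].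
Proof.
pose N := \bigcup_j \bigcap_M deviation M (j.+1%:R^-1).
have mN j : measurable (\bigcap_M deviation M (j.+1%:R^-1)).
  by apply: bigcapT_measurable => M; exact: measurable_deviation.
exists N; split.
- exact: bigcupT_measurable.
- apply/negligibleP; first exact: bigcupT_measurable.
  apply: negligible_bigcup => j; apply/negligibleP => //.
  apply/eqP; rewrite -measure_le0; apply/lee_addgt0Pr => e e0.
  have j0 : 0 < j.+1%:R^-1 :> R by rewrite invr_gt0.
  have e1 : 0 < e * j.+1%:R^-1 ^+ 2 / 2 by rewrite divr_gt0// mulr_gt0// exprn_gt0.
  move/cvgrPdist_lt: tau0 => /(_ _ e1) [M _ /(_ M (leqnn _))].
  rewrite /= sub0r normrN => /(le_lt_trans (ler_norm _)) h.
  rewrite add0e; apply: (@le_trans _ _ (P (deviation M j.+1%:R^-1))).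
    apply: le_measure; rewrite ?inE//; first exact: measurable_deviation.
    exact: bigcap_inf.
  apply: (le_trans (P_deviation _ j0)); rewrite lee_fin ler_pdivrMr ?exprn_gt0//.
  by rewrite mulrC -ler_pdivlMr// ltW.
move=> w Nw.
have cw : cvgn (s ^~ w).
  apply/cvgn_real_cauchyP => j; apply: contrapT => /forallNP h.
  apply: Nw; exists j => // M _; apply: contrapT => nD; apply: (h M) => i Mi.
  exact: deviationN.
split=> // M e nD; apply/ler_addgt0Pr => eta eta0.
move/cvgrPdist_lt: (cw) => /(_ _ eta0) [K _ HK].
have h1 := HK (maxn K M) (leq_maxl _ _).
have h2 := deviationN nD (leq_maxr K M).
set i := maxn K M in h1 h2.
rewrite (_ : _ - _ = (limn (s ^~ w) - s i w) + (s i w - s M w)); last by ring.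
rewrite (le_trans (ler_normD _ _))// addrC lerD// ltW//.
Qed.
End random_series.

(** * Convergence of the rescaled coefficients *)

Section power_sums.
Context {R : realType}.
Variable q : R.
Hypothesis q01 : 0 < q < 1.
Let q0 : 0 < q. Proof. by have /andP[] := q01. Qed.

Lemma cvg_powR_natN : (fun n : nat => n.+1%:R `^ (- q) : R) @ \oo --> 0.
Proof.
have -> : (fun n : nat => n.+1%:R `^ (- q) : R) = (fun n => n.+1%:R^-1 `^ q).
  by apply/funext => n; rewrite powRV.
apply: (@cvg_comp _ _ _ (fun n : nat => n.+1%:R^-1 : R) (fun x => x `^ q) _ (0^'+)).
  move=> A hA.
  have h : \forall n \near \oo, 0 < (n.+1%:R^-1 : R) -> A (n.+1%:R^-1 : R).
    exact: (@cvg_harmonic R _ hA).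
  by apply: filterS h => n; apply; rewrite invr_gt0.
exact: powR_cvg0.
Qed.

(** Telescoping against $-\frac2q(k+1)^{-q}$; the factor $2$ absorbs the ratio $(k+2)/(k+1)\le2$. *)
Lemma sum_powR_tail (M m : nat) :
  \sum_(M <= k < m) k.+1%:R `^ (- 1 - q) <= 2 / q * M.+1%:R `^ (- q) :> R.
Proof.
have [mM|/ltnW Mm] := leqP m M.
  by rewrite big_geq// mulr_ge0 ?divr_ge0 ?powR_ge0 ?(ltW q0).
pose f k : R := - (2 / q * k.+1%:R `^ (- q)).
apply: (@le_trans _ _ (\sum_(M <= k < m) (f k.+1 - f k))); last first.
  rewrite telescope_sumr// /f opprK addrC gerDl oppr_le0.
  by rewrite mulr_ge0 ?divr_ge0 ?powR_ge0 ?(ltW q0).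
apply: ler_sum => k _.
have -> : f k.+1 - f k = 2 / q * (k.+1%:R `^ (- q) - k.+2%:R `^ (- q)).
  by rewrite /f; ring.
set B : R := k.+1%:R; set A : R := k.+2%:R.
have B0 : 0 < B by rewrite /B ltr0n.
have A0 : 0 < A by rewrite /A ltr0n.
have AB : A = B + 1 by rewrite /A /B -natr1.
have B1 : 1 <= B by rewrite /B ler1n.
have := @powR_sub_ge R q A B q01 A0 (ltW B0); rewrite AB lerDl ler01 -AB => /(_ isT).
rewrite (_ : A - B = 1); last by rewrite AB; ring.
rewrite mulr1 powRB1// => h.
rewrite (_ : - 1 - q = - q - 1); last by ring.
rewrite powRB1// !powRN.
have Aq := powR_gt0 q A0; have Bq := powR_gt0 q B0.
have -> : 2 / q * ((B `^ q)^-1 - (A `^ q)^-1) =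
    2 / q * (A `^ q - B `^ q) / (A `^ q * B `^ q).
  by field; rewrite !gt_eqF.
rewrite ler_pdivlMr ?mulr_gt0//.
apply: (@le_trans _ _ (2 / q * (q * (A `^ q / A)))); last first.
  by rewrite ler_wpM2l// divr_ge0// ltW.
have -> : (B `^ q)^-1 / B * (A `^ q * B `^ q) = A `^ q * B^-1.
  by field; rewrite !gt_eqF.
have -> : 2 / q * (q * (A `^ q / A)) = A `^ q * (2 / A) by field; rewrite !gt_eqF.
rewrite ler_wpM2l ?powR_ge0// ler_pdivlMr// mulrC ler_pdivrMr//.
by move: B1; rewrite AB; lra.
Qed.

Lemma sum_powR_le (m : nat) :
  \sum_(j < m) j.+1%:R `^ (q - 1) <= m%:R `^ q / q :> R.
Proof.
elim: m => [|m IH]; first by rewrite big_ord0 divr_ge0 ?powR_ge0 ?(ltW q0).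
rewrite big_ord_recr/= (le_trans (lerD IH (lexx _)))//.
have := @powR_sub_ge R q m.+1%:R m%:R q01; rewrite ltr0n ler_nat => /(_ isT (ler0n _ _) (leqnSn _)).
rewrite (_ : m.+1%:R - m%:R = 1 :> R) ?mulr1; last by rewrite -natr1 addrAC subrr add0r.
by rewrite -lerBrDl -mulrBl ler_pdivlMr// mulrC.
Qed.
End power_sums.

(** * Square summability and $l^2$ limit of the coefficients *)

Section coefficient_limits.
Context {R : realType}.
Variables H sigma : R.
Hypotheses (H12 : 1/2 < H) (H1 : H < 1) (sigma0 : 0 < sigma).

Let al := H - 1/2.
Let p := H + 1/2.
(** Chosen so that the square of the power [al - 1] is the summable power [- 1 - q]; here
    $q=2-2H$. *)
Let q := 1 - 2 * al.
Let al0 : 0 < al. Proof. by rewrite subr_gt0. Qed.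
Let p0 : 0 < p. Proof. by rewrite /p; move: H12; lra. Qed.
Let q01 : 0 < q < 1.
Proof. by rewrite /q /al; apply/andP; split; move: H12 H1; lra. Qed.
Let q0 : 0 < q. Proof. by have /andP[] := q01. Qed.
Let al1 : 0 < 1 - al. Proof. by rewrite /al; move: H12 H1; lra. Qed.

(* Indices are shifted: [limit_coef k] is the limit of [coef N m k], the rescaled
   coefficient of the sign [k + 1] steps before step [n = m + 1]. *)
Definition limit_coef k : R := 2 * rho (hH H) k.+1.

Definition coef N m l : R := J H sigma N m.+1 (m - l) / (gH H sigma * N%:R `^ (- H)).

Let c := limit_coef.

Lemma gH_gt0 : 0 < gH H sigma.
Proof. by rewrite divr_gt0// mulr_gt0// cH_gt0. Qed.

Lemma limit_coef_ge k : p * al * k.+2%:R `^ (al - 1) <= c k.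
Proof. by have /andP[] := rho_bounds H12 H1 k. Qed.

Lemma limit_coef_le k : c k <= p * k.+1%:R `^ (al - 1).
Proof. by have /andP[] := rho_bounds H12 H1 k. Qed.

Lemma limit_coef_gt0 k : 0 < c k.
Proof.
by apply: lt_le_trans (limit_coef_ge k); rewrite !mulr_gt0// powR_gt0.
Qed.

Definition coef_tail M : R :=
  (H + 1/2) ^+ 2 * (2 / (1 - 2 * (H - 1/2)) * M.+1%:R `^ (- (1 - 2 * (H - 1/2)))).
Let tau := coef_tail.

Let powR_sqr k : (k.+1%:R `^ (al - 1)) ^+ 2 = k.+1%:R `^ (- 1 - q) :> R.
Proof.
rewrite -powR_mulrn ?powR_ge0// -powRrM; congr (_ `^ _).
by rewrite /q; ring.
Qed.

Lemma limit_coef_tail M m : \sum_(M <= k < m) c k ^+ 2 <= coef_tail M.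
Proof.
apply: le_trans (ler_wpM2l (sqr_ge0 p) (sum_powR_tail q01 M m)).
rewrite mulr_sumr; apply: ler_sum => k _.
rewrite -powR_sqr -exprMn lerXn2r ?nnegrE ?limit_coef_le//.
  by rewrite ltW// limit_coef_gt0.
by rewrite mulr_ge0 ?powR_ge0 ?ltW.
Qed.

Lemma limit_coef_tail0 : coef_tail @ \oo --> 0.
Proof.
rewrite -(mulr0 (p ^+ 2)); apply: cvgMr; rewrite -(mulr0 (2 / q)); apply: cvgMr.
exact: cvg_powR_natN.
Qed.

Lemma limit_coef_cvg0 : c @ \oo --> 0.
Proof.
apply/cvgrPdist_lt => e e0.
have e20 : 0 < e ^+ 2 by rewrite exprn_gt0.
move/cvgrPdist_lt: limit_coef_tail0 => /(_ _ e20); apply: filterS => k.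
rewrite !sub0r !normrN => /(le_lt_trans (ler_norm _)) h.
rewrite ger0_norm ?(ltW (limit_coef_gt0 k))//.
rewrite -(ltr_pXn2r (n := 2))// ?nnegrE ?(ltW e0) ?(ltW (limit_coef_gt0 k))//.
apply: le_lt_trans h; apply: le_trans (limit_coef_tail k k.+1).
by rewrite big_nat1.
Qed.

(** As [0 < al], the lower bound of [limit_coef_ge] dominates a multiple of $1/(k+2)$, and the
    harmonic series diverges. *)
Lemma limit_coef_series_dvg (A : R) : exists M, A < \sum_(k < M) c k.
Proof.
apply: contrapT => /forallNP hA.
have hb M : \sum_(k < M) c k <= A by rewrite leNgt; apply/negP; exact: hA.
apply: (@dvg_harmonic R); rewrite /series.
apply: nondecreasing_is_cvgn.
  apply/nondecreasing_seqP => n; rewrite /series/= big_nat_recr//= lerDl.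
  exact: harmonic_ge0.
(* The added $1$ pays for the first harmonic term, which has no counterpart in [limit_coef_ge]. *)
exists (A * (p * al)^-1 + 1) => _ [n _ <-] /=.
case: n => [|n].
  have A0 : 0 <= A by apply: le_trans (hb 0%N); rewrite big_ord0.
  by rewrite big_geq// addr_ge0// divr_ge0// mulr_ge0// ltW.
rewrite big_nat_recl//= /harmonic/= invr1 addrC lerD2r.
rewrite ler_pdivlMr ?mulr_gt0// mulr_suml.
apply: le_trans (hb n); rewrite -(big_mkord xpredT c).
apply: ler_sum => k _; apply: le_trans (limit_coef_ge k).
rewrite mulrC; apply: ler_wpM2l; first by rewrite mulr_ge0// ltW.
rewrite -[leLHS]powR_inv1// ler_powR ?ler1n//.
by rewrite -[leLHS]add0r lerD2r ltW.
Qed.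

Let C : R := p / (1 - al).

Let C_ge : p <= C.
Proof. by rewrite ler_pdivlMr// ler_piMr ?(ltW p0)// gerBl ltW. Qed.

Let C0 : 0 < C. Proof. exact: lt_le_trans C_ge. Qed.

Let scale_gt0 N : (0 < N)%N -> 0 < gH H sigma * N%:R `^ (- H).
Proof. by move=> N0; rewrite mulr_gt0 ?gH_gt0 ?powR_gt0// ltr0n. Qed.

(** The condition [l.+1 < m] excludes the first cell, whose left end is $0$. *)
Lemma coef_near N m l : (0 < N)%N -> (l.+1 < m)%N ->
  c l <= coef N m l <= (m.+1%:R / (m - l.+1)%:R) `^ al * c l.
Proof.
move=> N0 lm; have il : (0 < m - l.+1)%N by rewrite subn_gt0.
have := J_near_bounds H12 sigma0 l N0 il.
have -> : ((m - l.+1).+1 + l.+1 = m.+1)%N by rewrite addSn subnK// ltnW.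
have -> : ((m - l.+1).+1 = m - l)%N by rewrite -subSn// ltnW.
rewrite /coef -/al -/(limit_coef l) => /andP[h1 h2].
rewrite ler_pdivlMr ?scale_gt0// ler_pdivrMr ?scale_gt0// mulrC h1/=.
by apply: (le_trans h2); rewrite le_eqVlt; apply/orP; left; apply/eqP; rewrite /c; ring.
Qed.

Lemma coef_far N m l : (0 < N)%N -> (l < m)%N ->
  0 <= coef N m l <= C * l.+1%:R `^ (al - 1) * (m.+1%:R / (m - l)%:R) `^ al.
Proof.
move=> N0 lm.
have := J_far_bound H12 H1 sigma0 (m - l.+1) l N0.
have -> : ((m - l.+1).+1 + l.+1 = m.+1)%N by rewrite addSn subnK// ltnW.
have -> : ((m - l.+1).+1 = m - l)%N by rewrite -subSn// ltnW.
rewrite /coef -/al => /andP[h1 h2].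
rewrite divr_ge0 ?(ltW (scale_gt0 _))//= ler_pdivrMr ?scale_gt0//.
apply: (le_trans h2); rewrite le_eqVlt; apply/orP; left; apply/eqP.
by rewrite /C /gH -/p; field; rewrite !gt_eqF.
Qed.

(* The first term dominates if [2 (m - l) >= m + 1], the second one otherwise. *)
Lemma coef_diff_bound N m l : (0 < N)%N -> (l < m)%N ->
  (coef N m l - c l) ^+ 2 <=
    2 * C ^+ 2 * l.+1%:R `^ (- 1 - q)
    + 4 * C ^+ 2 * m.+1%:R `^ (- 2 * q) * (m - l)%:R `^ (q - 1).
Proof.
move=> N0 lm; have /andP[h1 h2] := coef_far N0 lm.
have ml0 : 0 < (m - l)%:R :> R by rewrite ltr0n subn_gt0.
have m0 : 0 < m.+1%:R :> R by rewrite ltr0n.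
have c0 := limit_coef_gt0 l.
set B := C * l.+1%:R `^ (al - 1) * (m.+1%:R / (m - l)%:R) `^ al in h2 *.
have cB : c l <= B.
  apply: (le_trans (limit_coef_le l)).
  apply: (@le_trans _ _ (C * l.+1%:R `^ (al - 1))); first by rewrite ler_wpM2r ?powR_ge0.
  apply: ler_peMr; first by apply: mulr_ge0; rewrite ?powR_ge0 ?(ltW C0).
  rewrite -[leLHS](powRr0 (m.+1%:R / (m - l)%:R)) ler_powR ?(ltW al0)//.
  by rewrite ler_pdivlMr// mul1r ler_nat (leq_trans (leq_subr _ _)).
(* Both coefficients lie in $[0,B]$, so their difference is at most [B] in absolute value. *)
apply: (@le_trans _ _ (B ^+ 2)).
  have hn : `|coef N m l - c l| <= B.
    by rewrite ler_norml; apply/andP; split; move: h1 h2 cB c0; lra.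
  by rewrite -real_normK ?num_real// lerXn2r// nnegrE (le_trans h1).
have -> : B ^+ 2 = C ^+ 2 * l.+1%:R `^ (- 1 - q) * (m.+1%:R / (m - l)%:R) `^ (1 - q).
  rewrite /B !exprMn powR_sqr; congr (_ * _).
  by rewrite -powR_mulrn ?powR_ge0// -powRrM; congr (_ `^ _); rewrite /q; ring.
have q1 : 0 <= 1 - q by have /andP[_ /ltW] := q01; rewrite subr_ge0.
have C20 : 0 <= C ^+ 2 by exact: sqr_ge0.
have X0 : 0 <= C ^+ 2 * l.+1%:R `^ (- 1 - q) by rewrite mulr_ge0 ?powR_ge0.
have [h|h] := leqP m.+1 (2 * (m - l))%N.
  have r2 : (m.+1%:R / (m - l)%:R) `^ (1 - q) <= 2.
    apply: (@le_trans _ _ (2 `^ (1 - q))).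
      rewrite ge0_ler_powR ?nnegrE ?divr_ge0//.
      by rewrite ler_pdivrMr// -natrM ler_nat.
    by rewrite ler1_powR ?ler1n// gerBl ltW.
  apply: (le_trans (ler_wpM2l X0 r2)).
  rewrite [leLHS]mulrC [leLHS]mulrA lerDl.
  by rewrite mulr_ge0 ?powR_ge0// mulr_ge0 ?powR_ge0// mulr_ge0.
(* In this case $l+1\ge(m+1)/2$, and $2^{1+q}\le4$. *)
have r4 : l.+1%:R `^ (- 1 - q) <= 4 * m.+1%:R `^ (- 1 - q) :> R.
  apply: (@le_trans _ _ ((m.+1%:R / 2) `^ (- 1 - q))).
    rewrite le0_ger_powR ?divr_gt0//; first by move: q0; lra.
    by rewrite ler_pdivrMr// -natrM ler_nat; move: lm h; clear; lia.
  rewrite powR_div// mulrC ler_wpM2r ?powR_ge0//.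
  rewrite (_ : 4 = 2 `^ 2%:R :> R); last by rewrite powR_mulrn// -natrX.
  by rewrite ler_powR ?ler1n//; have /andP[_] := q01; lra.
rewrite -[leLHS]add0r lerD//; first by apply: mulr_ge0; rewrite ?powR_ge0// mulr_ge0.
rewrite powR_div// (_ : - (1 - q) = q - 1); last by ring.
rewrite mulrA ler_wpM2r ?powR_ge0//.
have -> : m.+1%:R `^ (- 2 * q) = m.+1%:R `^ (- 1 - q) * m.+1%:R `^ (1 - q) :> R.
  rewrite -powRD; last by rewrite pnatr_eq0 implybT.
  by congr (_ `^ _); ring.
rewrite mulrA ler_wpM2r ?powR_ge0//.
by rewrite -[leRHS]mulrA [leRHS]mulrCA ler_wpM2l.
Qed.

(** Cut at a fixed [L]. Below it, the two-sided bound makes each term converge; above it,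
    [coef_diff_bound] leaves two small sums. None of these bounds depends on [N]. *)
Lemma coef_l2_cvg (e : R) : 0 < e -> exists m0, forall m N, (m0 <= m)%N -> (0 < N)%N ->
  \sum_(l < m) (coef N m l - c l) ^+ 2 <= e.
Proof.
move=> e0.
have e3 : 0 < e / 3 by rewrite divr_gt0.
(* Beyond [L], [v L] will bound the sum of the first terms of [coef_diff_bound], and [v m] that of
   the second ones. *)
pose v k : R := 4 * C ^+ 2 / q * k.+1%:R `^ (- q).
have vcvg : v @ \oo --> 0.
  by rewrite -(mulr0 (4 * C ^+ 2 / q)); apply: cvgMr; exact: cvg_powR_natN.
move/cvgrPdist_lt: vcvg => /(_ _ e3) [L _ HL].
have v0 k : 0 <= v k by rewrite mulr_ge0 ?powR_ge0// divr_ge0 ?(ltW q0)// mulr_ge0// sqr_ge0.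
have vL k : (L <= k)%N -> v k <= e / 3.
  by move=> /HL; rewrite /= sub0r normrN ger0_norm// => /ltW.
(* At [k = m - L - 1] this bounds the sum over the first [L] terms: their relative error is at most
   $(L+1)/(m-L)$, and $1/(m-L)^2$ is weakened to $1/(m-L)$ to reach a harmonic sequence. *)
pose w k : R := L.+1%:R ^+ 2 * tau 0 * (k.+1%:R^-1).
have wcvg : w @ \oo --> 0.
  by rewrite -(mulr0 (L.+1%:R ^+ 2 * tau 0)); apply: cvgMr; exact: cvg_harmonic.
move/cvgrPdist_lt: wcvg => /(_ _ e3) [K _ HK].
have tau00 : 0 <= tau 0.
  by rewrite mulr_ge0 ?sqr_ge0// mulr_ge0 ?powR_ge0// divr_ge0// ltW.
have wK k : (K <= k)%N -> w k <= e / 3.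
  move=> /HK; rewrite /= sub0r normrN ger0_norm// => [/ltW//|].
  by rewrite mulr_ge0// mulr_ge0// sqr_ge0.
exists (L + K).+1 => m N m0 N0.
have Lm : (L < m)%N by apply: leq_trans m0; rewrite ltnS leq_addr.
have mLK : (K <= (m - L).-1)%N by move: m0; clear; lia.
rewrite -(big_mkord xpredT (fun l => (coef N m l - c l) ^+ 2)).
rewrite (big_cat_nat (leq0n L) (ltnW Lm))/=.
have mL0 : 0 < (m - L)%:R :> R by rewrite ltr0n subn_gt0.
have s1 : \sum_(0 <= l < L) (coef N m l - c l) ^+ 2 <= w (m - L).-1.
  apply: (@le_trans _ _ (\sum_(0 <= l < L) (L.+1%:R / (m - L)%:R) ^+ 2 * c l ^+ 2)).
    rewrite !big_nat; apply: ler_sum => l /= lL.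
    have lm : (l.+1 < m)%N by exact: leq_ltn_trans Lm.
    have /andP[h1 h2] := coef_near N0 lm.
    have c0 := limit_coef_gt0 l.
    rewrite -exprMn lerXn2r ?nnegrE ?subr_ge0//.
      by rewrite mulr_ge0 ?divr_ge0// ltW.
    apply: (@le_trans _ _ (((m.+1%:R / (m - l.+1)%:R) `^ al - 1) * c l)).
      by rewrite mulrBl mul1r lerB.
    rewrite ler_wpM2r ?(ltW c0)//.
    have ml0 : 0 < (m - l.+1)%:R :> R by rewrite ltr0n subn_gt0.
    apply: (@le_trans _ _ (m.+1%:R / (m - l.+1)%:R - 1)).
      rewrite lerD2r ler1_powR//.
        by rewrite ler_pdivlMr// mul1r ler_nat (leq_trans (leq_subr _ _)).
      by have := al1; lra.
    apply: (@le_trans _ _ (m.+1%:R / (m - L)%:R - 1)).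
      rewrite lerD2r ler_pM2l ?ltr0n// lef_pV2 ?posrE// ler_nat.
      by rewrite leq_sub2l.
    rewrite lerBlDr -[X in _ + X](divff (lt0r_neq0 mL0)) -mulrDl ler_pM2r ?invr_gt0//.
    by rewrite -natrD ler_nat; move: Lm; clear; lia.
  rewrite -mulr_sumr.
  apply: (@le_trans _ _ ((L.+1%:R / (m - L)%:R) ^+ 2 * tau 0)).
    by rewrite ler_wpM2l ?sqr_ge0// limit_coef_tail.
  rewrite /w prednK ?subn_gt0// exprMn mulrAC -[leRHS]mulrA -mulrA.
  rewrite ler_wpM2l ?sqr_ge0// ler_wpM2l//.
  rewrite exprVn lef_pV2 ?posrE ?exprn_gt0//.
  by rewrite -natrX ler_nat expnS expn1 leq_pmulr// subn_gt0.
have s2 : \sum_(L <= l < m) (coef N m l - c l) ^+ 2 <= v L + v m.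
  apply: (@le_trans _ _ (\sum_(L <= l < m) (2 * C ^+ 2 * l.+1%:R `^ (- 1 - q)
    + 4 * C ^+ 2 * m.+1%:R `^ (- 2 * q) * (m - l)%:R `^ (q - 1)))).
    by rewrite !big_nat; apply: ler_sum => l /= /andP[_ lm]; exact: coef_diff_bound.
  rewrite big_split/= lerD// -mulr_sumr.
    have C2 : 0 <= 2 * C ^+ 2 by rewrite mulr_ge0// sqr_ge0.
    apply: (le_trans (ler_wpM2l C2 (sum_powR_tail q01 L m))).
    by rewrite /v le_eqVlt; apply/orP; left; apply/eqP; ring.
  have D0 : 0 <= 4 * C ^+ 2 * m.+1%:R `^ (- 2 * q).
    by rewrite mulr_ge0 ?powR_ge0// mulr_ge0// sqr_ge0.
  apply: (@le_trans _ _ (4 * C ^+ 2 * m.+1%:R `^ (- 2 * q) * (m%:R `^ q / q))).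
    rewrite ler_wpM2l//.
    apply: le_trans (sum_powR_le q01 m).
    apply: (@le_trans _ _ (\sum_(0 <= l < m) (m - l)%:R `^ (q - 1))).
      rewrite [leRHS](big_cat_nat (leq0n L) (ltnW Lm))/= lerDr.
      apply: sumr_ge0 => l _.
      exact: powR_ge0.
    rewrite big_mkord (reindex_inj rev_ord_inj)/= le_eqVlt; apply/orP; left; apply/eqP.
    by apply: eq_bigr => l _; rewrite subKn.
  have mE : m.+1%:R `^ (- q) = m.+1%:R `^ (- 2 * q) * m.+1%:R `^ q :> R.
    rewrite -powRD; last by rewrite pnatr_eq0 implybT.
    by congr (_ `^ _); ring.
  rewrite /v mE.
  apply: (@le_trans _ _ (4 * C ^+ 2 * m.+1%:R `^ (- 2 * q) * (m.+1%:R `^ q / q))); last first.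
    by rewrite le_eqVlt; apply/orP; left; apply/eqP; ring.
  rewrite ler_wpM2l// ler_wpM2r ?invr_ge0 ?(ltW q0)//.
  by rewrite ge0_ler_powR ?nnegrE ?(ltW q0)// ler_nat.
have h1 := vL L (leqnn _); have h2 := vL m (ltnW Lm); have h3 := wK _ mLK.
move: s1 s2 h1 h2 h3; lra.
Qed.
End coefficient_limits.

(** * Comparison of the counts with the limit law *)

Section counting.
Context {R : realType}.
Local Notation cube m := {ffun 'I_m -> bool}.
Local Notation cprob := (@cprob R _).

(** Greedy choice: as [c] tends to $0$, some new coefficient lies below [e], while the earlier ones
    are at least [2 * e]. Half of the new coefficient serves as the next [e]. *)
Lemma separated_indices (c : nat -> R) : (forall k, 0 < c k) -> c @ \oo --> 0 ->
  forall K, exists L e, [/\ uniq L, size L = K, 0 < e,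
    forall k, k \in L -> 2 * e <= c k &
    forall k l, k \in L -> l \in L -> k != l -> e < `|c k - c l|].
Proof.
move=> c0 ccvg; elim=> [|K [L [e [uL sL e0 Lc Le]]]]; first by exists [::], 1.
move/cvgrPdist_lt: ccvg => /(_ _ e0) [k _ /(_ k (leqnn _))].
rewrite /= sub0r normrN gtr0_norm// => ck.
have lt_new l : l \in L -> c k / 2 < `|c l - c k|.
  move=> /Lc lc; apply: lt_le_trans (ler_norm _); have := c0 k; move: lc ck; lra.
exists (k :: L), (c k / 2); split.
- rewrite /= uL andbT; apply/negP => /Lc; move: ck e0; lra.
- by rewrite /= sL.
- by rewrite divr_gt0.
- move=> l; rewrite inE => /predU1P[->|/Lc lc]; first by rewrite mulrC divfK.
  by move: lc ck e0; lra.
- move=> i j; rewrite !inE => /predU1P[->|iL] /predU1P[->|jL].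
  + by rewrite eqxx.
  + by move=> _; rewrite distrC; exact: lt_new.
  + by move=> _; exact: lt_new.
  + move=> ij; apply: le_lt_trans (Le _ _ iL jL ij); move: ck (c0 k); lra.
Qed.

(** At least $1/e$ separated coefficients force the probability down to [e]. They are chosen before
    [m] and [y], whence the uniformity. *)
Lemma cube_anticoncentration_unif (c : nat -> R) (e : R) :
  (forall k, 0 < c k) -> c @ \oo --> 0 -> 0 < e ->
  exists del M, 0 < del /\ forall m y, (M <= m)%N ->
    cprob (fun x : cube m => `|csum c x - y| <= del) <= e.
Proof.
move=> c0 ccvg e0.
pose K := (Num.truncn e^-1).+1.
have Ke : e^-1 <= K%:R by rewrite ltW// truncnS_gt.
have K0 : 0 < K%:R :> R by rewrite ltr0n.
have [L [del [uL sL del0 _ Le]]] := separated_indices c0 ccvg K.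
exists del, (\max_(k <- L) k).+1; split => // m y Mm.
have Lm k : k \in L -> (k < m)%N.
  by move=> kL; apply: leq_trans Mm; rewrite ltnS; exact: (@leq_bigmax_seq _ L xpredT id k kL isT).
have := cube_anticoncentration y uL Lm (fun k => ltW (c0 k)) Le.
rewrite sL -ler_pdivlMl// mulr1 => /le_trans; apply.
by rewrite invf_ple.
Qed.

Lemma csumB (b c : nat -> R) m (x : cube m) :
  csum (fun k => b k - c k) x = csum b x - csum c x.
Proof. by rewrite /csum -sumrB; apply: eq_bigr => k _; rewrite mulrBl. Qed.

(** The condition of [inA] after division by the positive scale; [g] and [a] stand for the rescaled
    [gn] and [an]. *)
Definition escapes (b : nat -> R) (g a : R) m (x : cube m) : bool :=
  (csum b x + g <= - a) || (- a <= csum b x - g).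

(** The margin [e] is spent as follows: a quarter on [g], a quarter on [a], and half on replacing
    [b] by [c] outside the last event. *)
Lemma escapes_le (b c : nat -> R) (g a e : R) m :
  `|g - 1| <= e / 4 -> `|a| <= e / 4 ->
  cprob (fun x : cube m => escapes b g a x) <=
  cprob (fun x : cube m => 1 - e < `|csum c x|)
  + cprob (fun x : cube m => e / 2 <= `|csum (fun k => b k - c k) x|).
Proof.
move=> ge ae; apply: cprobU => x; rewrite csumB /escapes => h.
rewrite orbC -implyNb -ltNge; apply/implyP => hd.
move: ge ae hd; rewrite !ler_norml ltr_norml ltr_normr.
move=> /andP[g1 g2] /andP[a1 a2] /andP[d1 d2]; apply/orP.
by case/orP: h => h; [right|left]; lra.
Qed.

Lemma escapes_ge (b c : nat -> R) (g a e : R) m :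
  `|g - 1| <= e / 4 -> `|a| <= e / 4 ->
  cprob (fun x : cube m => 1 + e < `|csum c x|) <=
  cprob (fun x : cube m => escapes b g a x)
  + cprob (fun x : cube m => e / 2 <= `|csum (fun k => b k - c k) x|).
Proof.
move=> ge ae; apply: cprobU => x; rewrite csumB /escapes => h.
rewrite orbC -implyNb -ltNge; apply/implyP => hd.
move: ge ae hd h; rewrite !ler_norml ltr_norml ltr_normr.
move=> /andP[g1 g2] /andP[a1 a2] /andP[d1 d2] h; apply/orP.
by case/orP: h => h; [right|left]; lra.
Qed.

(** The gap between the two thresholds is covered by windows around $1$ and $-1$, to which
    anticoncentration applies. *)
Lemma cprob_shell (c : nat -> R) (e : R) m :
  cprob (fun x : cube m => 1 - e < `|csum c x|) <=
  cprob (fun x : cube m => 1 + e < `|csum c x|)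
  + (cprob (fun x : cube m => `|csum c x - 1| <= e)
     + cprob (fun x : cube m => `|csum c x - (- 1)| <= e)).
Proof.
apply: (@le_trans _ _ (cprob (fun x : cube m => 1 + e < `|csum c x|)
    + cprob (fun x : cube m => (`|csum c x - 1| <= e) || (`|csum c x - (- 1)| <= e)))).
  apply: cprobU => x h; rewrite -implyNb -leNgt; apply/implyP => h2.
  move: h h2; rewrite !ler_norml ltr_normr => /orP h /andP[h1 h2].
  by case: h => h; apply/orP; [left|right]; apply/andP; split; lra.
by rewrite lerD2l; exact: cprobU.
Qed.
End counting.

(** * Rescaling of the counting condition *)

Section rescaling.
Context {R : realType}.
Variables H sigma : R.
Hypotheses (H12 : 1/2 < H) (H1 : H < 1) (sigma0 : 0 < sigma).
Local Notation cube m := {ffun 'I_m -> bool}.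
Local Notation cprob := (@cprob R _).
Let al := H - 1/2.
Let scale N := gH H sigma * N%:R `^ (- H).
Let scale0 N : (0 < N)%N -> 0 < scale N.
Proof. by move=> N0; rewrite mulr_gt0 ?gH_gt0 ?powR_gt0// ltr0n. Qed.

(** [coef] counts steps backwards from the current time, whereas [Yn] counts them forwards; this
    reversal is a bijection of the cube. *)
Let crev m (y : cube m) : cube m := [ffun j => y (rev_ord j)].

Let crev_inj m : injective (@crev m).
Proof.
apply: (can_inj (g := @crev m)) => y; apply/ffunP => j.
by rewrite !ffunE rev_ordK.
Qed.

Let Yn_rev N m (y : cube m) : (0 < N)%N ->
  Yn H sigma N m.+1 (crev y) = scale N * csum (coef H sigma N m) y.
Proof.
move=> N0; rewrite /Yn /csum mulr_sumr /= (reindex_inj rev_ord_inj)/=.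
apply: eq_bigr => l _; rewrite ffunE rev_ordK mulrA; congr (_ * _).
rewrite /coef mulrC divfK ?gt_eqF ?scale0//.
by rewrite -subSn// subSS.
Qed.

Lemma card_A_n (a : R -> R) N m : (0 < N)%N ->
  #|A_n H sigma a N m.+1|%:R / 2 ^+ m =
  cprob (fun x : cube m => escapes (coef H sigma N m)
    (gn H sigma N m.+1 / scale N) (an a N m.+1 / scale N) x).
Proof.
move=> N0; rewrite (_ : _ / _ = cprob (fun x : cube m => inA H sigma a N m.+1 x))//.
rewrite -(cprob_inj _ (@crev_inj m)); congr (cprob _); apply/funext => x.
have s0 := scale0 N0.
rewrite /inA /escapes /un /dn Yn_rev//; congr (_ || _).
  by rewrite -[in RHS]mulNr [in RHS]ler_pdivlMr// mulrDl divfK ?gt_eqF// [in RHS]mulrC.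
by rewrite -[in RHS]mulNr [in RHS]ler_pdivrMr// mulrBl divfK ?gt_eqF// [in RHS]mulrC.
Qed.

Lemma gn_scaled N m : (0 < N)%N -> (0 < m)%N ->
  `|gn H sigma N m.+1 / scale N - 1| <= m%:R^-1.
Proof.
move=> N0 m0; have s0 := scale0 N0.
have mR : 0 < m%:R :> R by rewrite ltr0n.
have /andP[h1 h2] := gn_bounds H12 sigma0 N0 m0.
have h3 : (m.+1%:R / m%:R) `^ (H - 1 / 2) <= 1 + m%:R^-1 :> R.
  apply: (@le_trans _ _ (m.+1%:R / m%:R)).
    rewrite ler1_powR//; last by move: H1; lra.
    by rewrite ler_pdivlMr// mul1r ler_nat.
  by rewrite -natr1 mulrDl divff ?gt_eqF// mul1r.
rewrite ger0_norm.
  rewrite lerBlDl ler_pdivrMr// (le_trans h2)// [leRHS]mulrC.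
  by rewrite ler_wpM2l// ltW.
by rewrite subr_ge0 ler_pdivlMr// mul1r.
Qed.

(** The rescaled value is $a(\cdot)N^{H-1}/g_H$; [a] is bounded on the segment, and $N\ge m+1$ makes
    the bound free of [N]. *)
Lemma an_scaled (a : R -> R) : {within `[0, 1], continuous a} -> exists B, forall N m, (m < N)%N ->
  `|an a N m.+1 / scale N| <= B * m.+1%:R `^ (- (1 - H)).
Proof.
move=> ca.
have [u _ Hu] := EVT_max ler01 ca; have [v _ Hv] := EVT_min ler01 ca.
have g0 := gH_gt0 H12 H1 sigma0.
exists ((`|a u| + `|a v|) / gH H sigma) => N m mN.
have N0 : (0 < N)%N by exact: leq_ltn_trans mN.
have NR : 0 < N%:R :> R by rewrite ltr0n.
have s0 := scale0 N0.
have x01 : (m.+1%:R / N%:R : R) \in `[0, 1].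
  by rewrite in_itv/= divr_ge0//= ler_pdivrMr// mul1r ler_nat.
have ab : `|a (m.+1%:R / N%:R)| <= `|a u| + `|a v|.
  have := Hu _ x01; have := Hv _ x01.
  have := ler_norm (a u); have := ler_norm (- a v); rewrite normrN.
  have := normr_ge0 (a u); have := normr_ge0 (a v).
  by move=> *; rewrite ler_norml; apply/andP; split; lra.
have -> : an a N m.+1 / scale N = a (m.+1%:R / N%:R) / gH H sigma * N%:R `^ (- (1 - H)).
  have -> : N%:R `^ (- (1 - H)) = N%:R `^ H / N%:R :> R.
    by rewrite -powRB1//; congr (_ `^ _); ring.
  rewrite /an /scale powRN; field.
  by rewrite !gt_eqF// powR_gt0.
have gV : 0 <= (gH H sigma)^-1 by rewrite invr_ge0 ltW.
rewrite !normrM (ger0_norm (powR_ge0 _ _)) (ger0_norm gV).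
apply: ler_pM.
- by rewrite mulr_ge0.
- exact: powR_ge0.
- by rewrite ler_wpM2r.
- by rewrite le0_ger_powR// ?ler_nat//; move: H1; lra.
Qed.
End rescaling.

(** * The limit law and the uniform convergence of the counts *)

Section limit_law.
Context {R : realType} {d : measure_display} {T : measurableType d}.
Variables (P : probability T R) (xi : nat -> T -> R).
Hypothesis iid : iid_rademacher P xi.
Variables H sigma : R.
Hypotheses (H12 : 1/2 < H) (H1 : H < 1) (sigma0 : 0 < sigma).
Local Notation cube m := {ffun 'I_m -> bool}.
Local Notation cprob := (@cprob R _).
Let c := limit_coef H.
Let g0 := gH_gt0 H12 H1 sigma0.

Definition exit_event := [set w | `|YH H sigma xi w| > gH H sigma].
Let E := exit_event.

Lemma measurable_exit_event : measurable E.
Proof.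
have mY : measurable_fun setT (YH H sigma xi).
  apply: measurable_funM => //.
  apply: measurable_fun_limn => n; apply: measurable_sum => k.
  by apply: measurable_funM => //; case: iid.
have mN : measurable_fun setT (fun w => `|YH H sigma xi w|).
  exact: measurableT_comp.
have := mN measurableT _ (measurable_itv `]gH H sigma, +oo[).
congr measurable; apply/seteqP; split => w /=; rewrite in_itv/= andbT => //.
by case.
Qed.

(** Off the null sets, [YH] is [gH] times the limit of the sums [csum], the factor $2$ being
    absorbed by [limit_coef]; then [random_series_cvg] applies. *)
Lemma YH_approx : exists N : set T, [/\ measurable N, P N = 0%E &
  forall w, ~ N w -> forall M e, ~ deviation xi c M e w ->
    `|YH H sigma xi w / gH H sigma - csum c (bvec xi M w)| <= e].
Proof.
have [N1 [mN1 PN1 hN1]] := sign_or_negligible iid.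
have [N2 [mN2 PN2 hN2]] := random_series_cvg iid
  (limit_coef_tail H12 H1) (limit_coef_tail0 H12 H1).
exists (N1 `|` N2); split; first exact: measurableU.
  apply/eqP; rewrite -measure_le0 (le_trans (measureU2 _ mN1 mN2))//.
  by rewrite [X in (X + _)%E]PN1 [X in (_ + X)%E]PN2 adde0.
move=> w /not_orP[w1 w2] M e nD.
have [cw h] := hN2 _ w2.
suff -> : YH H sigma xi w = gH H sigma * limn (fun m => csum c (bvec xi m w)).
  by rewrite mulrAC divff ?mul1r ?gt_eqF//; exact: h.
rewrite /YH; set l := limn (fun m => csum c (bvec xi m w)).
suff -> : limn (fun n => \sum_(1 <= k < n) rho (hH H) k * xi k w) = l / 2.
  by field.
(* The sum in [YH] starts at $1$, so its value at index [n.+1] involves [n] signs. *)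
apply: cvg_lim => //; rewrite -cvg_shiftS.
have -> : (fun n => \sum_(1 <= k < n.+1) rho (hH H) k * xi k w) =
    (fun n => csum c (bvec xi n w) / 2).
  apply/funext => n; rewrite big_add1/= big_mkord /csum mulr_suml.
  apply: eq_bigr => k _; rewrite ffunE -(hN1 _ w1) /c /limit_coef.
  by field.
exact: cvgMl cw.
Qed.

Let tau M := 2 * coef_tail H M.

Let tau0 : tau @ \oo --> 0.
Proof.
by rewrite -(mulr0 2); apply: cvgMr; exact: (limit_coef_tail0 H12 H1).
Qed.

Let P_dev M e : 0 < e -> (P (deviation xi c M e) <= (tau M / e ^+ 2)%:E)%E.
Proof. exact: (P_deviation iid (limit_coef_tail H12 H1)). Qed.

Let PE : P E = (fine (P E))%:E.
Proof. by rewrite fineK// fin_num_measure//; exact: measurable_exit_event. Qed.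

(** Off the event [deviation xi c m e] and a null set, the normalised limit is within [e] of the sum
    of [m] signs, so the threshold $1$ moves by at most [e]. *)
Lemma exit_event_le m e : 0 < e ->
  fine (P E) <= cprob (fun x : cube m => 1 - e < `|csum c x|) + tau m / e ^+ 2.
Proof.
move=> e0; have [N [mN PN hN]] := YH_approx.
rewrite -lee_fin -PE EFinD.
pose Q (x : cube m) := 1 - e < `|csum c x|.
have mQ := measurable_bvec iid Q.
have mD := measurable_deviation iid c m e.
apply: (@le_trans _ _ (P ([set w | Q (bvec xi m w)] `|` deviation xi c m e `|` N))).
  apply: le_measure; rewrite ?inE.
  - exact: measurable_exit_event.
  - by apply: measurableU => //; exact: measurableU.
  move=> w wE; have [|nN] := pselect (N w); [by right|left].
  have [|nD] := pselect (deviation xi c m e w); [by right|left].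
  have := hN _ nN _ _ nD; rewrite /= /Q.
  have : 1 < `|YH H sigma xi w / gH H sigma|.
    by rewrite normrM normfV (gtr0_norm g0) ltr_pdivlMr// mul1r.
  set y := YH _ _ _ _ / _; set s := csum _ _ => y1 ys.
  have := ler_normD (y - s) s; rewrite subrK; move: y1 ys; lra.
apply: (le_trans (measureU2 _ _ mN)); first exact: measurableU.
rewrite [X in (_ + X)%E]PN adde0.
apply: (le_trans (measureU2 _ mQ mD)); apply: leeD; last exact: P_dev.
by rewrite [leLHS](P_bvec iid Q).
Qed.

Lemma exit_event_ge m e : 0 < e ->
  cprob (fun x : cube m => 1 + e < `|csum c x|) <= fine (P E) + tau m / e ^+ 2.
Proof.
move=> e0; have [N [mN PN hN]] := YH_approx.
rewrite -lee_fin EFinD -PE.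
pose Q (x : cube m) := 1 + e < `|csum c x|.
have mQ := measurable_bvec iid Q.
have mD := measurable_deviation iid c m e.
have mE := measurable_exit_event.
rewrite -(P_bvec iid Q).
apply: (@le_trans _ _ (P (E `|` deviation xi c m e `|` N))).
  apply: le_measure; rewrite ?inE//.
  - by apply: measurableU => //; exact: measurableU.
  move=> w wQ; have [|nN] := pselect (N w); [by right|left].
  have [|nD] := pselect (deviation xi c m e w); [by right|left].
  have := hN _ nN _ _ nD; rewrite /E /exit_event /=.
  rewrite /= /Q in wQ => ys.
  suff : 1 < `|YH H sigma xi w / gH H sigma|.
    by rewrite normrM normfV (gtr0_norm g0) ltr_pdivlMr// mul1r.
  move: ys wQ; set y := YH _ _ _ _ / _; set s := csum _ _ => ys s1.
  have := ler_normB y (y - s); rewrite opprB addrC subrK; move: s1 ys; lra.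
apply: (le_trans (measureU2 _ _ mN)); first exact: measurableU.
rewrite [X in (_ + X)%E]PN adde0.
by apply: (le_trans (measureU2 _ mE mD)); apply: leeD => //; exact: P_dev.
Qed.

Let tau_small (e : R) : 0 < e -> exists M, forall m, (M <= m)%N -> tau m <= e.
Proof.
move=> e0; move/cvgrPdist_lt: tau0 => /(_ _ e0) [M _ HM]; exists M => m /HM.
by rewrite /= sub0r normrN => /(le_lt_trans (ler_norm _))/ltW.
Qed.

(** Take [M] with $\sum_{k<M}c_k>2=1+e$ for $e=1$. The bound $2^{-(M+1)}$ of [cube_positive] does
    not depend on [m], so for large [m] the deviation costs at most half of it. *)
Lemma exit_event_gt0 : 0 < fine (P E).
Proof.
have [M hM] := limit_coef_series_dvg H12 H1 2.
have e0 : 0 < (2 ^+ M.+1)^-1 / 2 :> R by rewrite divr_gt0// invr_gt0 exprn_gt0.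
have [K HK] := tau_small e0.
pose m := maxn M K.
have h1 := cube_positive (leq_maxl M K : (M <= m)%N) hM.
have h2 := exit_event_ge m ltr01.
have h3 := HK m (leq_maxr _ _).
have h4 : cprob (fun x : cube m => 2 < csum (limit_coef H) x) <=
    cprob (fun x : cube m => 1 + 1 < `|csum c x|).
  apply: cprob_le => x hx; apply: lt_le_trans (ler_norm _).
  by move: hx; rewrite /c; lra.
move: h1; rewrite -ler_pdivrMl ?exprn_gt0// mulr1 => h1.
move: h2; rewrite expr1n divr1.
have : 0 < (2 ^+ M.+1)^-1 :> R by rewrite invr_gt0 exprn_gt0.
move: e0 h1 h3 h4; lra.
Qed.

(** The error is at most $3e/4$: $e/4$ from Chebyshev, $e/8$ from each of the two windows, $e/4$
    from the deviation of the series. Anticoncentration fixes [del] first; the ranks [K1] to [K4]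
    then depend on it. *)
Lemma A_n_uniform_limit (a : R -> R) (e : R) : {within `[0, 1], continuous a} -> 0 < e ->
  exists n0, forall m N, (n0 <= m)%N -> (m < N)%N ->
    `|#|A_n H sigma a N m.+1|%:R / 2 ^+ m - fine (P E)| <= e.
Proof.
move=> ca e0.
have e40 : 0 < e / 4 by rewrite divr_gt0.
have e80 : 0 < e / 8 by rewrite divr_gt0.
have [del [M [del0 HM]]] := cube_anticoncentration_unif
  (limit_coef_gt0 H12 H1) (limit_coef_cvg0 H12 H1) e80.
have t0 : 0 < e / 4 * del ^+ 2 by rewrite mulr_gt0// exprn_gt0.
have [K1 HK1] := tau_small t0.
have del20 : 0 < del / 2 by rewrite divr_gt0.
have l0 : 0 < e / 4 * (del / 2) ^+ 2 by rewrite mulr_gt0// exprn_gt0.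
have [K2 HK2] := coef_l2_cvg H12 H1 sigma0 l0.
have [B HB] := an_scaled H12 H1 sigma0 ca.
have del40 : 0 < del / 4 by rewrite divr_gt0.
have q01 : 0 < 1 - H < 1 by apply/andP; split; move: H12 H1; lra.
have : (fun n : nat => B * n.+1%:R `^ (- (1 - H))) @ \oo --> 0.
  by rewrite -(mulr0 B); apply: cvgMr; exact: cvg_powR_natN.
move/cvgrPdist_lt => /(_ _ del40) [K3 _ HK3].
have [K4 _ HK4] := near_infty_natSinv_lt (PosNum del40).
(* [K4.+1], because the bound on the rescaled [gn] is $1/m$ rather than $1/(m+1)$. *)
exists (maxn M (maxn K1 (maxn K2 (maxn K3 K4.+1)))) => m N.
rewrite !geq_max => /and5P[mM mK1 mK2 mK3 mK4] mN.
have N0 : (0 < N)%N by exact: leq_ltn_trans mN.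
rewrite (card_A_n H12 H1 sigma0 a m N0).
set g := gn _ _ _ _ / _; set b := an _ _ _ / _.
have ge : `|g - 1| <= del / 4.
  have m0 : (0 < m)%N by exact: leq_trans mK4.
  apply: (le_trans (gn_scaled H12 H1 sigma0 N0 m0)).
  have := HK4 m.-1; rewrite /= prednK// -ltnS prednK// => /(_ mK4).
  by move=> /ltW.
have be : `|b| <= del / 4.
  apply: (le_trans (HB _ _ mN)); have := HK3 _ mK3.
  by rewrite /= sub0r normrN => /(le_lt_trans (ler_norm _))/ltW.
have h1 := escapes_le (coef H sigma N m) c m ge be.
have h2 := escapes_ge (coef H sigma N m) c m ge be.
have h3 : cprob (fun x : cube m =>
    del / 2 <= `|csum (fun k => coef H sigma N m k - c k) x|) <= e / 4.
  apply: (le_trans (cube_chebyshev _ _ del20)).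
  by rewrite ler_pdivrMr ?exprn_gt0//; exact: HK2.
have h4 := cprob_shell c del m.
have h5 := HM m 1 mM; have h6 := HM m (- 1) mM.
have h7 := exit_event_le m del0; have h8 := exit_event_ge m del0.
have h9 : tau m / del ^+ 2 <= e / 4 by rewrite ler_pdivrMr ?exprn_gt0//; exact: HK1.
move: h1 h2 h3 h4 h5 h6 h7 h8 h9; rewrite /c.
set p1 := cprob (fun x => escapes _ _ _ x).
set p2 := cprob (fun x => 1 - del < _).
set p3 := cprob (fun x => 1 + del < _).
set p4 := cprob (fun x => del / 2 <= _).
set p5 := cprob (fun x => `|_ - 1| <= _).
set p6 := cprob (fun x => `|_ - - 1| <= _).
set p7 := tau m / _.
move=> *; rewrite ler_norml; apply/andP; split; lra.
Qed.
End limit_law.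

(** * Weighted means over the levels of the tree *)

Section tree_count.
Context {R : realType}.

Lemma card_A_all (H sigma : R) (a : R -> R) N :
  #|A_all H sigma a N| = (\sum_(m < N) #|A_n H sigma a N m.+1|)%N.
Proof.
rewrite -sum1_card.
rewrite (eq_bigr (fun m : 'I_N =>
    \sum_(x : {ffun 'I_m -> bool} | inA H sigma a N m.+1 x) 1)%N); last first.
  by move=> m _; rewrite -sum1_card; apply: eq_bigl => x; rewrite inE.
rewrite (sig_big_dep xpredT (fun (m : 'I_N) x => inA H sigma a N m.+1 x) (fun _ _ => 1%N))/=.
by apply: eq_bigl => x; rewrite inE.
Qed.

Lemma sum_pow2 N : \sum_(m < N) 2 ^+ m = 2 ^+ N - 1 :> R.
Proof.
elim: N => [|N IH]; first by rewrite big_ord0 expr0 subrr.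
by rewrite big_ord_recr/= IH exprS; ring.
Qed.

(** The first [n0] levels have total weight below $2^{n_0}$, negligible against $2^N-1$; on the
    others the error is at most [e / 2]. Uniformity in [N] matters, since the weights concentrate on
    [m] near [N]. *)
Lemma weighted_mean_cvg (x : nat -> nat -> R) (p : R) :
  (forall N m, 0 <= x N m <= 1) -> 0 <= p <= 1 ->
  (forall e, 0 < e -> exists n0, forall m N, (n0 <= m)%N -> (m < N)%N -> `|x N m - p| <= e) ->
  (fun N => (\sum_(m < N) 2 ^+ m * x N m) / (2 ^+ N - 1)) @ \oo --> p.
Proof.
move=> x01 p01 xp; apply/cvgrPdist_le => e e0.
have e20 : 0 < e / 2 by rewrite divr_gt0.
have [n0 Hn0] := xp _ e20.
(* Together with $N\le2^N-1$, this rank gives $2^{n_0}\le\frac e2(2^N-1)$. *)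
have [K _ HK] := near_infty_natSinv_lt (PosNum (divr_gt0 e20 (exprn_gt0 n0 (ltr0n _ 2)))).
exists (maxn K.+1 n0) => // N; rewrite /= geq_max => /andP[KN n0N].
have N0 : (0 < N)%N by exact: leq_trans KN.
have NR : 0 < N%:R :> R by rewrite ltr0n.
have pN : N%:R <= 2 ^+ N - 1 :> R.
  by rewrite lerBrDr natr1 -natrX ler_nat ltn_expl.
have p0 : 0 < 2 ^+ N - 1 :> R by exact: lt_le_trans pN.
have -> : p - (\sum_(m < N) 2 ^+ m * x N m) / (2 ^+ N - 1) =
    (\sum_(m < N) 2 ^+ m * (p - x N m)) / (2 ^+ N - 1).
  apply: (mulIf (lt0r_neq0 p0)); rewrite mulrBl !divfK ?lt0r_neq0//.
  under [in RHS]eq_bigr do rewrite mulrBr.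
  by rewrite sumrB -mulr_suml sum_pow2 mulrC.
rewrite normrM normfV (gtr0_norm p0) ler_pdivrMr//.
apply: (le_trans (ler_norm_sum _ _ _)).
apply: (@le_trans _ _ (\sum_(m < N) ((if (m < n0)%N then 2 ^+ m else 0) + e / 2 * 2 ^+ m))).
  apply: ler_sum => m _; rewrite normrM ger0_norm ?exprn_ge0//.
  case: ltnP => [_|mn0].
    rewrite -[leLHS]addr0; apply: lerD.
      apply: ler_piMr; rewrite ?exprn_ge0// ler_norml.
      by move: (x01 N m) p01 => /andP[? ?] /andP[? ?]; apply/andP; split; lra.
    by rewrite mulr_ge0 ?exprn_ge0 ?(ltW e20).
  by rewrite add0r mulrC ler_wpM2r ?exprn_ge0// distrC Hn0.
rewrite big_split/= -mulr_sumr sum_pow2 -big_mkcond/=.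
rewrite -(big_ord_widen N (fun m => 2 ^+ m) n0N) sum_pow2.
have h : 2 ^+ n0 <= e / 2 * (2 ^+ N - 1).
  have := HK N.-1; rewrite /= prednK// -ltnS prednK// => /(_ KN)/ltW.
  rewrite -div1r ler_pdivrMr// mulrAC ler_pdivlMr ?exprn_gt0// mul1r => /le_trans; apply.
  by rewrite ler_wpM2l// ltW.
move: h; set D := 2 ^+ N - 1; set u := 2 ^+ n0; lra.
Qed.
End tree_count.

Theorem theorem3p3 (R : realType) (H sigma : R) (a : R -> R)
  (d : measure_display) (T : measurableType d) (P : probability T R)
  (xi : nat -> T -> R) :
  1/2 < H -> H < 1 -> 0 < sigma ->
  {within `[0, 1], continuous a} ->
  iid_rademacher P xi ->
  let p := P [set w | `|YH H sigma xi w| > gH H sigma] in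
  (forall Ns : nat -> nat, (forall n, (n <= Ns n)%N) ->
     (fun n => (#|A_n H sigma a (Ns n) n|%:R / 2 ^+ n.-1)%:E) @ \oo --> p) /\
  (0 < p)%E /\
  (fun N => (#|A_all H sigma a N|%:R / (2 ^+ N - 1))%:E) @ \oo --> p.
Proof.
move=> H12 H1 sigma0 ca iid p.
have mE := measurable_exit_event iid H sigma.
have pE : p = (fine p)%:E by rewrite fineK// fin_num_measure.
have unif e : 0 < e -> exists n0, forall m N, (n0 <= m)%N -> (m < N)%N ->
    `|#|A_n H sigma a N m.+1|%:R / 2 ^+ m - fine p| <= e.
  exact: A_n_uniform_limit.
split; [|split].
- move=> Ns Nsn; rewrite pE; apply: cvg_EFin; first exact: nearW.
  apply/cvgrPdist_le => e e0; have [n0 Hn0] := unif _ e0.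
  (* [n = 0] lies below this rank; for $n=m+1$ the hypothesis $n\le N_n$ reads $m<N_n$. *)
  exists n0.+1 => // -[//|m] /= mn0; rewrite distrC.
  exact: Hn0.
- by rewrite pE lte_fin; exact: (exit_event_gt0 iid H12 H1 sigma0).
rewrite pE; apply: cvg_EFin; first exact: nearW.
pose x N m : R := #|A_n H sigma a N m.+1|%:R / 2 ^+ m.
have x01 N m : 0 <= x N m <= 1.
  rewrite divr_ge0 ?exprn_ge0//= ler_pdivrMr ?exprn_gt0// mul1r -natrX ler_nat.
  by rewrite -(card_cube m) max_card.
have p01 : 0 <= fine p <= 1.
  by rewrite -!lee_fin -pE measure_ge0 probability_le1.
have := weighted_mean_cvg x01 p01 unif.
apply: cvg_trans; apply: near_eq_cvg; apply: nearW => N /=.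
rewrite card_A_all natr_sum; congr (_ / _); apply: eq_bigr => m _.
by rewrite /x mulrC divfK// expf_neq0.
Qed.
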